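(* Let $\Lambda$ be a parameter shift from $\lambda_-$ to $\lambda_+$ and let $(X(s),\Lambda(s))$ be a stable path with $X_\pm=\lim_{s\to\pm\infty}X(s)$. If $(X(s),\Lambda(s))$ is forward inflowing stable, then there is no R-tipping away from $X_-$; that is, for every $r>0$ the pullback attractor $x^r$ to $X_-$ satisfies $x^r(t)\to X_+$ as $t\to\infty$.
   Context: Setting. $U\subset\mathbb{R}^n$ is open and $f\in C^2(U\times\mathbb{R},\mathbb{R}^n)$. For fixed $\lambda$ consider the autonomous system $\dot x=f(x,\lambda)$. Let $\lambda_-<\lambda_+$. A parameter shift (from $\lambda_-$ to $\lambda_+$) is a function $\Lambda\in C^2(\mathbb{R},(\lambda_-,\lambda_+))$ with $\lim_{s\to\pm\infty}\Lambda(s)=\lambda_\pm$ and $\lim_{s\to\pm\infty}\Lambda'(s)=0$. For $r>0$ consider the non-autonomous system $\dot x=f(x,\Lambda(rt))$, equivalently the augmented system $\dot x=f(x,\Lambda(s))$, $\dot s=r$ with $s=rt$. Attracting equilibrium: an equilibrium of $\dot x=f(x,\lambda)$ at which all eigenvalues of $\partial_xf$ have negative real part. $\mathbb{B}(p,\lambda)$ denotes the basin of attraction in $U$ of an attracting equilibrium $p$ of $\dot x=f(x,\lambda)$. Stable path: $(X(s),\Lambda(s))$, $s\in\mathbb{R}$, with $X$ continuous, $X(s)\in U$ an attracting equilibrium of $\dot x=f(x,\Lambda(s))$ for every $s$, and such that the limits $X_\pm=\lim_{s\to\pm\infty}X(s)$ exist in $U$ and are attracting equilibria of $\dot x=f(x,\lambda_\pm)$.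 Pullback attractor: for each $r>0$ there is a unique trajectory $x^r(t)$ of $\dot x=f(x,\Lambda(rt))$ with $x^r(t)\to X_-$ as $t\to-\infty$; it is called the pullback attractor to $X_-$. R-tipping away from $X_-$ occurs if for some $r>0$ one does not have $x^r(t)\to X_+$ as $t\to\infty$. Forward inflowing stable: the stable path $(X(s),\Lambda(s))$ is forward inflowing stable if for each $s\in\mathbb{R}$ there is a compact set $K(s)\subset U$ such that (i) $X(s)\in\operatorname{Int}K(s)$ for all $s\in\mathbb{R}$; (ii) if $s_1<s_2$ then $K(s_1)\subset K(s_2)$; (iii) if $x\in\partial K(s)$, then $f(x,\Lambda(s))$ points strictly into $K(s)$; (iv) $X_\pm\in\operatorname{Int}K_\pm$, where $K_-=\bigcap_{s\in\mathbb{R}}K(s)$ and $K_+=\overline{\bigcup_{s\in\mathbb{R}}K(s)}$; (v) $K_+\subset\mathbb{B}(X_+,\lambda_+)$ and $K_+$ is compact. Here a vector $v$ at $x\in\partial K$ points strictly into a closed set $K$ if there is $\varepsilon>0$ such that $x+hw\in K$ for all $0<h<\varepsilon$ and all $w$ with $|w-v|<\varepsilon$. *)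

(* Defs.v *)
From HB Require Import structures.
From mathcomp Require Import all_boot all_order all_algebra.
From mathcomp.real_closed Require Import complex.
From mathcomp Require Import all_classical all_reals all_analysis.

Set Implicit Arguments.
Unset Strict Implicit.
Unset Printing Implicit Defensive.

Import Order.TTheory GRing.Theory Num.Theory.
Import numFieldNormedType.Exports.

Local Open Scope ring_scope.
Local Open Scope classical_set_scope.

(* Meant for V finite-dimensional and A open.  The derivative of order j <= k
   is continuous iff its values on each choice of j directions are, because V
   is finite-dimensional. *)
Fixpoint Ck_on (R : realType) (V W : normedModType R) (k : nat) (A : set V)
    (f : V -> W) : Prop :=
  if k is k'.+1 then
    (forall x, A x -> differentiable f x) /\
    (forall v, Ck_on k' A ('D_v f))
  else forall x, A x -> {for x, continuous f}.

Section Flows.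
Variables (R : realType) (n : nat).
Local Notation E := 'rV[R]_n.
Implicit Types (U K : set E) (f : E -> R -> E) (g : R -> E -> E)
  (x : R -> E) (Lam : R -> R) (X : R -> E) (T : \bar R).

(* Solution in U of x' = g t x on an interval J of times.  At an end point
   belonging to J, continuity forces the one-sided derivative to be g t x. *)
Definition solution_on U g (J : set R) x : Prop :=
  [/\ {within J, continuous x},
      forall t, J t -> U (x t) &
      forall t, J° t -> is_derive t 1 x (g t (x t))].

Definition before T : set R := [set t | (t%:E < T)%E].

(* Maximal solution with time domain ]-oo, T[; the values of x at times
   t >= T are irrelevant. *)
Definition trajectory U g T x : Prop :=
  [/\ (-oo < T)%E,
      solution_on U g (before T) x &
      forall T' y, (T <= T')%E -> solution_on U g (before T') y ->
        (forall t, before T t -> y t = x t) -> T' = T].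

Definition attracting_equilibrium U f (lam : R) (p : E) : Prop :=
  [/\ U p, f p lam = 0 &
      forall z : R[i],
        eigenvalue (map_mx (real_complex R) (jacobian (f ^~ lam) p)) z ->
        complex.Re z < 0].

Definition basin U f (p : E) (lam : R) : set E :=
  [set x0 | exists x, [/\ solution_on U (fun _ y => f y lam) `[0, +oo[ x,
                          x 0 = x0 & x t @[t --> +oo] --> p]].

Definition parameter_shift (lm lp : R) Lam : Prop :=
  [/\ Ck_on 2 [set: R] Lam,
      forall s, lm < Lam s < lp,
      Lam s @[s --> -oo] --> lm /\ Lam s @[s --> +oo] --> lp &
      Lam^`() s @[s --> -oo] --> (0 : R) /\
      Lam^`() s @[s --> +oo] --> (0 : R)].

Definition stable_path U f (lm lp : R) Lam X (Xm Xp : E) : Prop :=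
  [/\ continuous X,
      forall s, attracting_equilibrium U f (Lam s) (X s),
      X s @[s --> -oo] --> Xm /\ X s @[s --> +oo] --> Xp &
      attracting_equilibrium U f lm Xm /\ attracting_equilibrium U f lp Xp].

(* The notion does not depend on the choice of the norm. *)
Definition points_strictly_into K (p v : E) : Prop :=
  exists2 e : R, 0 < e &
    forall (h : R) (w : E), 0 < h < e -> `|w - v| < e -> K (p + h *: w).

Definition forward_inflowing_stable U f (lp : R) Lam X (Xm Xp : E) : Prop :=
  exists K : R -> set E,
    let Km := \bigcap_(s in [set: R]) K s in
    let Kp := closure (\bigcup_(s in [set: R]) K s) in
    (forall s, compact (K s) /\ K s `<=` U) /\
    [/\ forall s, (K s)° (X s),
        forall s1 s2, s1 < s2 -> K s1 `<=` K s2,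
        forall s p, (closure (K s) `\` (K s)°) p ->
          points_strictly_into (K s) p (f p (Lam s)),
        Km° Xm /\ Kp° Xp &
        Kp `<=` basin U f Xp lp /\ compact Kp].

Definition pullback_attractor U f Lam (r : R) (Xm : E) T x : Prop :=
  trajectory U (fun t y => f y (Lam (r * t))) T x /\
  x t @[t --> -oo] --> Xm.

Definition R_tipping U f Lam (Xm Xp : E) : Prop :=
  exists r : R, 0 < r /\
  exists T x, pullback_attractor U f Lam r Xm T x /\
    ~ (T = +oo%E /\ x t @[t --> +oo] --> Xp).

End Flows.

(* Main.v *)
Require Import Defs.
From mathcomp Require Import all_boot all_order all_algebra.
From mathcomp.real_closed Require Import complex.
From mathcomp Require Import all_classical all_reals all_analysis.
From mathcomp Require Import ring lra.

(* The pullback attractor starts in the intersection of the K(s), and since the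
   K(s) increase and the field points strictly into each of them, x(t) lies in
   K(rt) as long as it exists.  So it stays in the compact set K_+, hence exists
   for all time and accumulates at some z in K_+.  The trajectory of z under the
   limiting system at lp tends to Xp; as the parameter tends to lp, continuous
   dependence on a finite time interval brings x arbitrarily close to Xp at
   arbitrarily late times.  Finally a quadratic Lyapunov function, strict for the
   linearization at Xp and hence for all parameters near lp, keeps x there. *)

Import Order.TTheory GRing.Theory Num.Theory.
Import numFieldNormedType.Exports.
Set Implicit Arguments.
Unset Strict Implicit.
Unset Printing Implicit Defensive.
Local Open Scope ring_scope.
Local Open Scope classical_set_scope.

(** * Quadratic forms decreasing along a Hurwitz matrix *)

Section LyapunovForm.
Variable R : realType.
Local Notation C := R[i].
Local Notation toC := (real_complex R).
Implicit Types z w : C.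

(** The inclusion of K_+ in the basin is pointwise and gives no uniform rate of approach to Xp, so
    the late behaviour is decided at a single accumulation point z and a single time tau. The
    constants depend on each other accordingly: the trapping radius at Xp determines tau along the
    solution through z, tau determines the tolerance for continuous dependence, and the tolerances
    determine how late the visit near z must be, which accumulation at infinity can meet. The
    Lyapunov form has to be real although the eigenvalues are complex; it is built from the real and
    imaginary parts of coordinates in a complex basis. The norm of row vectors is the maximum norm,
    which is not everywhere differentiable, so a quadratic form replaces it wherever a distance is
    differentiated, also for continuous dependence. *)

Lemma Re_sum (I : Type) (r : seq I) (P : pred I) (F : I -> C) :
  complex.Re (\sum_(i <- r | P i) F i) = \sum_(i <- r | P i) complex.Re (F i).
Proof. by apply: big_morph => // -[a b] [c d]. Qed.

Lemma Im_sum (I : Type) (r : seq I) (P : pred I) (F : I -> C) :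
  complex.Im (\sum_(i <- r | P i) F i) = \sum_(i <- r | P i) complex.Im (F i).
Proof. by apply: big_morph => // -[a b] [c d]. Qed.

(** The real part of z times the conjugate of w, that is, the Euclidean inner product of the complex
    plane. *)
Definition dotC z w : R :=
  complex.Re z * complex.Re w + complex.Im z * complex.Im w.

Lemma dotC_suml (I : Type) (r : seq I) (P : pred I) (F : I -> C) w :
  dotC (\sum_(i <- r | P i) F i) w = \sum_(i <- r | P i) dotC (F i) w.
Proof. by rewrite /dotC Re_sum Im_sum !mulr_suml -big_split. Qed.

Lemma dotC_ge0 z : 0 <= dotC z z.
Proof. by rewrite /dotC -!expr2 addr_ge0// sqr_ge0. Qed.

Lemma dotC_mul_le (K : R) z w s : `|complex.Re s| <= K -> `|complex.Im s| <= K ->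
  dotC (z * s) w <= K * (dotC z z + dotC w w).
Proof.
case: z w s => [p q] [u v] [a b] /=; rewrite /dotC /= => aK bK.
have K0 : 0 <= K by apply: le_trans aK.
have H c x y : `|c| <= K -> c * (x * y) <= K * ((x ^+ 2 + y ^+ 2) / 2).
  move=> cK; apply: (le_trans (ler_norm _)); rewrite normrM ler_pM//.
  rewrite ler_norml; apply/andP; split.
    have := sqr_ge0 (x + y); nra.
  have := sqr_ge0 (x - y); nra.
have bK' : `|- b| <= K by rewrite normrN.
have := H a p u aK; have := H (- b) q u bK'; have := H b p v bK; have := H a q v aK.
nra.
Qed.

(** A diagonal entry s contributes Re s times a squared modulus, its imaginary part cancelling; an
    off-diagonal entry costs at most K times a sum of two squared moduli. Granting the diagonal the
    same slack makes the double sum uniform, and each squared modulus is then counted 2n times. *)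
Lemma dotC_dominated n (S : 'M[C]_n) (a K : R) (z : 'rV[C]_n) : 0 <= K ->
  (forall i, complex.Re (S i i) <= - a) ->
  (forall i j, i != j ->
     `|complex.Re (S i j)| <= K /\ `|complex.Im (S i j)| <= K) ->
  \sum_j dotC ((z *m S) 0 j) (z 0 j) <=
    (K *+ (2 * n) - a) * \sum_j dotC (z 0 j) (z 0 j).
Proof.
move=> K0 Sd So; pose N i := dotC (z 0 i) (z 0 i).
have N0 i : 0 <= N i by exact: dotC_ge0.
have entry i j : dotC (z 0 i * S i j) (z 0 j) <=
    K * (N i + N j) - a * (N i *+ (i == j)).
  have [<-|ij] := eqVneq i j; last first.
    rewrite mulr0n mulr0 subr0.
    by apply: dotC_mul_le; have [] := So i j ij.
  rewrite mulr1n; apply: (@le_trans _ _ (complex.Re (S i i) * N i)).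
    by rewrite /N /dotC; case: (z 0 i) (S i i) => [p q] [u v] /=; lra.
  have := ler_wpM2r (N0 i) (Sd i); have := mulr_ge0 K0 (N0 i); lra.
apply: (@le_trans _ _ (\sum_j \sum_i (K * (N i + N j) - a * (N i *+ (i == j))))).
  apply: ler_sum => j _; rewrite mxE dotC_suml.
  by apply: ler_sum => i _; exact: entry.
have -> : \sum_j \sum_i (K * (N i + N j) - a * (N i *+ (i == j))) =
    \sum_j ((K * \sum_i N i + K * N j *+ n) - a * N j).
  apply: eq_bigr => j _; rewrite sumrB -mulr_sumr big_split /= sumr_const card_ord.
  rewrite mulrDr -mulr_sumr mulrnAr; congr (_ - _ * _).
  by rewrite (bigD1 j)//= eqxx big1 ?addr0// => i /negbTE ->.
rewrite sumrB big_split /= sumr_const card_ord -mulr_sumr sumrMnl -mulr_sumr.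
rewrite -/N -[X in X <= _]/(_ - _) mulrBl mulrnA mulr2n -!mulrnAl.
by rewrite mulrnDl mulrDl lexx.
Qed.

(** The bilinear form with matrix Q Q^T. Keeping the factor Q makes it positive by construction and
    reduces definiteness to [row_free Q]. *)
Definition gram n m (Q : 'M[R]_(n, m)) (v w : 'rV[R]_n) : R :=
  \sum_j (v *m Q) 0 j * (w *m Q) 0 j.

(** Schur triangularization, of which only the invertibility of P is kept. A diagonal entry of a
    triangular matrix is a root of its characteristic polynomial, and [v *m P] turns an eigenvector
    of the conjugate into one of A. Size 0 is separate because [Schur] asks for a positive size. *)
Lemma Schur_eigenvalue n (A : 'M[C]_n) :
  exists2 P : 'M[C]_n, P \in unitmx &
    exists2 T : 'M[C]_n, P *m A = T *m P &
      (forall i j : 'I_n, (i < j)%N -> T i j = 0) /\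
      (forall i, eigenvalue A (T i i)).
Proof.
case: n A => [|n] A.
  exists 1%:M; first exact: unitmx1.
  by exists A; [rewrite mul1mx mulmx1 | split=> -[]].
have [P /unitarymx_unit Pu /= tP] := Schur A isT.
exists P => //; exists (conjmx P A).
  by rewrite conjumx// mulmxKV.
split=> [i j ij|i]; first by move/is_trig_mxP: tP; apply.
have : eigenvalue (conjmx P A) (conjmx P A i i).
  rewrite eigenvalue_root_char char_poly_trig// /root horner_prod.
  by rewrite (bigD1 i)//= hornerXsubC subrr mul0r.
move=> /eigenvalueP[v vP v0]; apply/eigenvalueP; exists (v *m P).
  by rewrite -mulmxA -[P *m A](mulmxKV Pu) -conjumx// mulmxA vP scalemxAl.
apply: contraNneq v0 => vP0; apply/eqP.
by rewrite -(mulmxK Pu v) vP0 mul0mx.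
Qed.

(* Conjugating the triangular Schur form by diag(e^i) multiplies its (i, j) entry
   by e^(i - j), which makes the off-diagonal part negligible for small e. *)
Lemma hurwitz_gram n (J : 'M[R]_n) :
  (forall z : C, eigenvalue (map_mx toC J) z -> complex.Re z < 0) ->
  exists (Q : 'M[R]_(n, n + n)) (a : R),
    [/\ 0 < a, row_free Q & forall v, gram Q (v *m J) v <= - a * gram Q v v].
Proof.
move=> hJ; have [P Pu [T PJ [Ttrig Teig]]] := Schur_eigenvalue (map_mx toC J).
(* The rate is written 2a because half of it will absorb the off-diagonal part. The default value 1
   keeps the minimum positive when n = 0. *)
have [a a0 Ta] : exists2 a, 0 < a & forall i, complex.Re (T i i) <= - (2 * a).
  pose m := \big[Num.min/1]_i (- complex.Re (T i i)).
  have m0 : 0 < m by rewrite /m; apply: lt_bigmin => // i _; rewrite oppr_gt0;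
    exact/hJ/Teig.
  exists (m / 2); first by rewrite divr_gt0.
  move=> i; rewrite mulrC divfK// lerNr; exact: bigmin_le.
have [M M0 TM] : exists2 M : R, 0 < M & forall i j,
    `|complex.Re (T i j)| <= M /\ `|complex.Im (T i j)| <= M.
  pose M := \big[Num.max/1]_(ij : 'I_n * 'I_n)
    Num.max `|complex.Re (T ij.1 ij.2)| `|complex.Im (T ij.1 ij.2)|.
  exists M; first by apply: (@lt_le_trans _ _ 1) => //; exact: bigmax_ge_id.
  move=> i j; apply/andP; rewrite -ge_max.
  exact: (le_bigmax _ (fun ij : 'I_n * 'I_n =>
    Num.max `|complex.Re (T ij.1 ij.2)| `|complex.Im (T ij.1 ij.2)|) (i, j)).
(* [e <= 1] gives e^(i - j) <= e below the diagonal, and the last bound limits the off-diagonal loss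
   to a. *)
have [e [e0 e1 eM]] : exists e : R, [/\ 0 < e, e <= 1 & (e * M) *+ (2 * n) <= a].
  have D0 : 0 < M *+ (2 * n) + a by rewrite ltr_wpDl// mulrn_wge0// ltW.
  exists (a / (M *+ (2 * n) + a)); split; first by rewrite divr_gt0.
    by rewrite ler_pdivrMr// mul1r lerDr mulrn_wge0// ltW.
  by rewrite -mulrnAr mulrAC ler_pdivrMr// ler_pM2l// lerDl ltW.
pose d : 'rV[C]_n := \row_i toC (e ^+ i).
pose d' : 'rV[C]_n := \row_i toC (e ^- i).
have dd' : diag_mx d' *m diag_mx d = 1%:M.
  apply/matrixP => i j; rewrite mul_diag_mx !mxE; case: eqP => _;
    last by rewrite mulr0n mulr0.
  by rewrite !mulr1n -rmorphM /= mulVf ?rmorph1// expf_neq0// gt_eqF.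
pose W := diag_mx d *m P; pose S := diag_mx d *m T *m diag_mx d'.
have Wu : W \in unitmx by rewrite unitmx_mul Pu andbT; case: (mulmx1_unit dd').
have WJ : W *m map_mx toC J = S *m W.
  by rewrite /W /S -!mulmxA PJ; congr (_ *m _);
    rewrite [diag_mx d' *m _]mulmxA dd' mul1mx.
have SE i j : S i j = toC (e ^+ i * e ^- j) * T i j.
  by rewrite /S mul_mx_diag mxE mul_diag_mx !mxE rmorphM /=; ring.
(* [v *m B] are the coordinates of v in the basis of the rows of W. Their real and imaginary parts
   side by side give a real Q of width n + n, whose Gram form is the sum of the squared moduli of
   these coordinates. *)
pose B := invmx W.
pose Q := row_mx (map_mx (@complex.Re R) B) (map_mx (@complex.Im R) B).
have mapR (v : 'rV[R]_n) : v *m map_mx (@complex.Re R) B = map_mx (@complex.Re R)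
  (map_mx toC v *m B).
  apply/rowP => j; rewrite !mxE Re_sum; apply: eq_bigr => i _; rewrite !mxE.
  by case: (B i j) => p q /=; ring.
have mapI (v : 'rV[R]_n) : v *m map_mx (@complex.Im R) B = map_mx (@complex.Im R)
  (map_mx toC v *m B).
  apply/rowP => j; rewrite !mxE Im_sum; apply: eq_bigr => i _; rewrite !mxE.
  by case: (B i j) => p q /=; ring.
have gramE u v : gram Q u v = \sum_j dotC ((map_mx toC u *m B) 0 j)
  ((map_mx toC v *m B) 0 j).
  rewrite /gram big_split_ord /= -big_split; apply: eq_bigr => j _ /=.
  by rewrite !mul_mx_row !row_mxEl !row_mxEr !mapR !mapI !mxE.
exists Q, a; split=> //.
  apply/inj_row_free => v; rewrite mul_mx_row mapR mapI => vQ0.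
  have : map_mx toC v *m B = 0.
    have := vQ0; rewrite -[0 in X in X -> _]row_mx0 => /eq_row_mx[r0 i0].
    apply/rowP => j; move/rowP/(_ j): r0; move/rowP/(_ j): i0; rewrite !mxE.
    by case: (\sum_i _) => p q /= -> ->.
  move/(congr1 (mulmx^~ W)); rewrite mulmxKV// mul0mx => v0.
  by apply/rowP => j; move/rowP/(_ j): v0; rewrite !mxE => -[].
move=> v; rewrite !gramE.
have -> : map_mx toC (v *m J) *m B = (map_mx toC v *m B) *m S.
  rewrite map_mxM -!mulmxA; congr (_ *m _).
  by rewrite -[LHS]mul1mx -(mulVmx Wu) -[LHS]mulmxA [W *m _]mulmxA WJ mulmxK.
have eM0 : 0 <= e * M by rewrite mulr_ge0// ltW.
apply: le_trans (@dotC_dominated _ S (2 * a) (e * M) _ eM0 _ _) _.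
- move=> i; rewrite SE divff ?expf_neq0 ?gt_eqF// rmorph1 mul1r; exact: Ta.
- move=> i j ij; have [ji|ij'|/val_inj ij'] := ltngtP j i;
  last by rewrite ij' eqxx in ij.
    have [TR TI] := TM i j.
    have eij : 0 <= e ^+ i * e ^- j <= e.
      rewrite mulr_ge0 ?invr_ge0 ?exprn_ge0 ?(ltW e0)//=.
      rewrite -(subnKC ji) exprD exprS mulrAC -[e * _ * _]mulrA divff ?mulr1.
        by rewrite ler_piMr ?(ltW e0)// exprn_ile1// ltW.
      by rewrite expf_neq0// gt_eqF.
    rewrite SE; move: (e ^+ i * e ^- j) eij => x eij.
    case: (T i j) TR TI => p q /= TR TI.
    rewrite !mul0r subr0 addr0 !normrM !(ger0_norm (andP eij).1).
    by case/andP: eij => ? ?; split; apply: ler_pM.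
  by rewrite SE Ttrig// mulr0 normr0.
- apply: ler_wpM2r; first by apply: sumr_ge0 => j _; exact: dotC_ge0.
  by have : e * M *+ (2 * n) - (2 * a) <= - a by lra.
Qed.
End LyapunovForm.

(** * Calculus for functions of a real variable *)

Section Calculus.
Variable R : realType.

Lemma within_itvP (V : normedModType R) (y : R -> V) (A : set R) :
  {within A, continuous y} <->
  forall s, A s -> forall e : R, 0 < e -> exists2 d : R, 0 < d &
    forall t, A t -> `|t - s| < d -> `|y t - y s| < e.
Proof.
split=> [/subspace_continuousP yc s As e e0|yc].
  have /cvgrPdist_lt/(_ e e0) := yc s As.
  move=> /nbhs_ballP[d /= d0 dP]; exists d => // t At ts.
  by rewrite distrC; apply: dP => //; rewrite /ball /= distrC.
apply/subspace_continuousP => s As; apply/cvgrPdist_lt => e e0.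
have [d d0 dP] := yc s As e e0.
apply/nbhs_ballP; exists d => //= t ts At.
by rewrite distrC; apply: dP => //; rewrite distrC.
Qed.

Lemma within_comp (V W : normedModType R) (A : set R) (y : R -> V) (g : V -> W) :
  continuous g -> {within A, continuous y} -> {within A, continuous (g \o y)}.
Proof. by move=> gc yc x; apply: (@continuous_comp (subspace A) _ _ y g); [exact:
  yc | exact: gc]. Qed.

Lemma row_coord_le n (v : 'rV[R]_n) i : `|v 0 i| <= `|v|.
Proof. by rewrite [leRHS]mx_normrE; exact: (le_bigmax _ (fun i => `|v i.1 i.2|)
  (0, i)). Qed.

Lemma row_norm_le n (v : 'rV[R]_n) K :
  0 <= K -> (forall i, `|v 0 i| <= K) -> `|v| <= K.
Proof.
by move=> K0 vK; rewrite [leLHS]mx_normrE; apply: bigmax_le => // -[i j] _;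
  rewrite ord1.
Qed.

Lemma is_derive_rowP n (y : R -> 'rV[R]_n) (t : R) dy :
  is_derive t 1 y dy <-> forall i, is_derive t 1 (fun s => y s 0 i) (dy 0 i).
Proof.
split=> [[yd <-] i|yd].
  apply: DeriveDef; first exact: (derivable_mxP _ _ _).1.
  by rewrite derive_mx// mxE.
have yd' : derivable y t 1.
  by apply/derivable_mxP => i j; rewrite ord1; have [] := yd j.
apply: DeriveDef => //; apply/rowP => i; rewrite derive_mx// mxE.
by have [] := yd i.
Qed.

Lemma is_derive_continuous (V : normedModType R) (y : R -> V) (t : R) dy :
  is_derive t 1 y dy -> {for t, continuous y}.
Proof. by move=> [yd _]; apply/differentiable_continuous/derivable1_diffP. Qed.

(** The intermediate point depends on the coordinate, hence one i at a time. *)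
Lemma MVT_row n (y dy : R -> 'rV[R]_n) (a b : R) i : a < b ->
  (forall t, a < t < b -> is_derive t 1 y (dy t)) ->
  {within `[a, b], continuous y} ->
  exists2 c, a < c < b & y b 0 i - y a 0 i = dy c 0 i * (b - a).
Proof.
move=> ab yd yc.
have yid t : t \in `]a, b[%R -> is_derive t 1 (fun s => y s 0 i) (dy t 0 i).
  by rewrite in_itv /= => tab; have /is_derive_rowP := yd t tab.
have yic : {within `[a, b], continuous (fun s => y s 0 i)}.
  apply: (@within_comp _ _ _ y (fun M : 'rV[R]_n => M 0 i)) yc.
  exact: coord_continuous.
by have [c + ->] := MVT ab yid yic; rewrite in_itv /= => ?; exists c.
Qed.

Lemma mean_value_ineq n (y dy : R -> 'rV[R]_n) (a b M : R) : a <= b ->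
  (forall t, a < t < b -> is_derive t 1 y (dy t)) ->
  {within `[a, b], continuous y} ->
  (forall t, a < t < b -> `|dy t| <= M) ->
  `|y b - y a| <= M * (b - a).
Proof.
rewrite le_eqVlt => /predU1P[->|ab]; first by rewrite !subrr normr0 mulr0.
move=> yd yc dyM.
have M0 : 0 <= M.
  by apply: (le_trans (normr_ge0 _) (dyM ((a + b) / 2) _)); rewrite midf_lt//= midf_lt.
apply: row_norm_le => [|i]; first by rewrite mulr_ge0// subr_ge0 ltW.
rewrite 2!mxE.
have [s sab ->] := MVT_row i ab yd yc.
rewrite normrM (@gtr0_norm _ (b - a)) ?subr_gt0// ler_wpM2r ?subr_ge0 ?(ltW ab)//.
by apply: le_trans (row_coord_le _ _) _; exact: dyM.
Qed.

(** Right after the last time with u <= c, u would run through the band between c and d, where by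
    the mean value theorem it cannot grow. The sign of the derivative is asked only in the band
    because the estimates to which this is applied hold only below an upper level. *)
Lemma barrier (u du : R -> R) (a b c d : R) :
  {within `[a, b], continuous u} ->
  (forall t, a < t < b -> is_derive t 1 u (du t)) ->
  c < d ->
  (forall t, a < t < b -> c < u t < d -> du t <= 0) ->
  u a <= c -> forall t, a <= t <= b -> u t <= c.
Proof.
move=> /within_itvP uc ud cd du0 uac t1 /andP[at1 t1b].
rewrite leNgt; apply/negP => ct1.
pose S := [set t | a <= t <= t1 /\ u t <= c].
have Sa : S a by split; rewrite ?lexx.
have Sub : has_ubound S by exists t1 => t [/andP[]].
have hS : has_sup S by split; [exists a|].
pose s := sup S.
have as_ : a <= s by exact: ub_le_sup.
have st1 : s <= t1 by apply: ge_sup => //; [exists a | move=> t [/andP[]]].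
have sab : `[a, b]%classic s by rewrite /= in_itv /= as_ (le_trans st1).
have usc : u s <= c.
  rewrite leNgt; apply/negP => cus.
  have [e e0 eP] := uc s sab (u s - c) ltac:(by rewrite subr_gt0).
  have [t [/andP[at_ tt1] utc] st] := sup_adherent e0 hS.
  have ts : t <= s by apply: ub_le_sup => //; split=> //; rewrite at_.
  have := eP t; rewrite /= in_itv /= at_ (le_trans tt1)// => /(_ isT).
  rewrite ler0_norm ?subr_le0// opprB ltrBlDl -ltrBlDr => /(_ st).
  by rewrite ltr_norml => /andP[+ _]; rewrite opprB; lra.
have st1' : s < t1.
  by rewrite lt_neqAle st1 andbT; apply: contraTneq ct1 => <-; rewrite -leNgt.
have [e e0 eP] := uc s sab (d - c) ltac:(by rewrite subr_gt0).
pose t2 := Num.min t1 (s + e / 2).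
have st2 : s < t2 by rewrite lt_min st1' ltrDl divr_gt0.
have t21 : t2 <= t1 by rewrite ge_min lexx.
have t2e : t2 <= s + e / 2 by rewrite ge_min lexx orbT.
have above t : s < t -> t <= t2 -> c < u t < d.
  move=> st tt2; have tt1 := le_trans tt2 t21; apply/andP; split.
    rewrite ltNge; apply/negP => utc.
    have : t <= s by apply: ub_le_sup => //; split=> //;
      rewrite tt1 andbT (le_trans as_)// ltW.
    by rewrite leNgt st.
  have := eP t; rewrite /= in_itv /= (le_trans as_ (ltW st)) (le_trans tt1)// =>
    /(_ isT).
  rewrite gtr0_norm ?subr_gt0// => tse.
  have : `|u t - u s| < d - c by apply: tse; lra.
  by rewrite ltr_norml => /andP[_]; lra.
have ud' t : t \in `]s, t2[%R -> is_derive t 1 u (du t).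
  rewrite in_itv /= => /andP[st tt2]; apply: ud.
  by rewrite (le_lt_trans as_ st)/= (lt_le_trans tt2)// (le_trans t21).
have uc' : {within `[s, t2], continuous u}.
  apply: (@continuous_subspaceW _ _ _ `[a, b]); last exact/within_itvP.
  by apply: subset_itvScc; rewrite bnd_simp// (le_trans t21).
have [x xst2] := MVT st2 ud' uc'.
move: xst2; rewrite in_itv /= => /andP[sx xt2] uE.
have dux : du x <= 0.
  apply: du0; last by apply: above => //; exact: ltW.
  by rewrite (le_lt_trans as_ sx)/= (lt_le_trans xt2)// (le_trans t21).
have /andP[ut2 _] := above t2 st2 (lexx _).
have : du x * (t2 - s) <= 0 by rewrite mulr_le0_ge0// subr_ge0 ltW.
lra.
Qed.

(* One-sided information suffices: both one-sided derivatives come from the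
   mean value theorem and the continuity of g at T. *)
Lemma is_derive_extend n (y g : R -> 'rV[R]_n) (T e : R) : 0 < e ->
  {for T, continuous y} -> {for T, continuous g} ->
  (forall t, t != T -> `|t - T| < e -> is_derive t 1 y (g t)) ->
  is_derive T 1 y (g T).
Proof.
move=> e0 yc gc yd.
suff H : (fun h => h^-1 *: (y (h *: (1 : R) + T) - y T)) @ 0^' --> g T.
  by apply: DeriveDef; [apply/cvg_ex; exists (g T) | exact/cvg_lim].
apply/cvgrPdist_le => eps eps0.
have /cvgrPdist_lt/(_ _ eps0)/nbhs_ballP[d /= d0 dP] := gc.
pose r := Num.min d e.
have r0 : 0 < r by rewrite lt_min d0.
have ycw a b : T - r < a -> b < T + r -> {within `[a, b], continuous y}.
  move=> ra br; apply: continuous_in_subspaceT => t; rewrite inE /= in_itv /= =>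
    /andP[at_ tb].
  have [->//|tT] := eqVneq t T.
  apply: is_derive_continuous (yd t tT _).
  by have : r <= e by [rewrite ge_min lexx orbT]; rewrite ltr_norml; lra.
have ydw t : T - r < t < T + r -> t != T -> is_derive t 1 y (g t).
  move=> tr tT; apply: yd => //; have : r <= e by rewrite ge_min lexx orbT.
  by rewrite ltr_norml; lra.
near=> h.
have h0 : h != 0 by near: h; exact: nbhs_dnbhs_neq.
have hr : `|h| < r by near: h; exact: dnbhs0_lt.
rewrite /= [h%:A]mulr1.
move: (hr); rewrite ltr_norml => /andP[hr1 hr2].
have key i : exists2 s, `|s - T| < r & y (h + T) 0 i - y T 0 i = g s 0 i * h.
  have [hpos|hneg|h00] := ltrgtP 0 h; last by rewrite -h00 eqxx in h0.
    have ab : T < h + T by rewrite ltrDr.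
    have [t /andP[Tt th]||s /andP[Ts sh] ->] := @MVT_row n y g T (h + T) i ab.
    - by apply: ydw; [lra | rewrite gt_eqF].
    - by apply: ycw; lra.
    - by exists s; [rewrite ltr_norml; lra | congr (_ * _); lra].
  have ab : h + T < T by rewrite gtrDr.
  have [t /andP[Tt th]||s /andP[Ts sh] E] := @MVT_row n y g (h + T) T i ab.
  - by apply: ydw; [lra | rewrite lt_eqF].
  - by apply: ycw; lra.
  - by exists s; [rewrite ltr_norml; lra | rewrite -[LHS]opprB E; lra].
apply: row_norm_le => [|i]; first exact: ltW.
have [s sT E] := key i; rewrite !mxE E mulrC mulfK//.
apply: (@le_trans _ _ `|g T - g s|).
  by apply: le_trans (row_coord_le _ i); rewrite !mxE.
apply/ltW/dP; rewrite /ball /= distrC (lt_le_trans sT)//.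
by rewrite ge_min lexx.
Unshelve. all: by end_near. Qed.

Lemma antiderivative (h : R -> R) (a b : R) : continuous h ->
  exists H : R -> R, forall t, a < t < b -> is_derive t 1 H (h t).
Proof.
move=> hc.
exists (fun x => \int[lebesgue_measure]_(t in `[a, x]) h t)%R => t /andP[at_ tb].
have [] := @continuous_FTC1_closed R h a t b tb _ at_ (hc t).
  apply: continuous_compact_integrable; first exact: segment_compact.
  exact: continuous_subspaceT.
by move=> ? <-; rewrite derive1E; exact: derivableP.
Qed.

Lemma antiderivative_row n (h : R -> 'rV[R]_n) (a b : R) : continuous h ->
  exists H : R -> 'rV[R]_n, forall t, a < t < b -> is_derive t 1 H (h t).
Proof.
move=> hc.
have /choice[H HP] : forall i, exists H : R -> R, forall t, a < t < b ->
  is_derive t 1 H (h t 0 i).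
  move=> i; apply: (@antiderivative (fun t => h t 0 i)) => t.
  apply: (@continuous_comp _ _ _ h (fun M : 'rV[R]_n => M 0 i)); first exact: hc.
  exact: coord_continuous.
exists (fun t => \row_i H i t) => t tab; apply/is_derive_rowP => i.
by under eq_fun do rewrite mxE; exact: HP.
Qed.
End Calculus.

(** * Bounds and derivatives for Gram forms, local Lipschitz estimate *)

Lemma norm_mulmx_le (R : realType) n p (A : 'M[R]_(n, p)) :
  exists2 C : R, 0 < C & forall v : 'rV[R]_n, `|v *m A| <= C * `|v|.
Proof.
exists (1 + \sum_i \sum_j `|A i j|).
  by rewrite ltr_pwDl// sumr_ge0// => i _; rewrite sumr_ge0.
move=> v; have S0 : 0 <= \sum_i \sum_j `|A i j|.
  by rewrite sumr_ge0// => i _; rewrite sumr_ge0.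
apply: row_norm_le => [|j]; first by rewrite mulr_ge0// addr_ge0.
rewrite mxE (le_trans (ler_norm_sum _ _ _))//.
apply: (@le_trans _ _ (\sum_i `|v| * \sum_j `|A i j|)).
  apply: ler_sum => i _; rewrite normrM ler_pM//; first exact: row_coord_le.
  by rewrite (bigD1 j)//= lerDl sumr_ge0.
by rewrite -mulr_sumr mulrC ler_wpM2r// lerDr.
Qed.

Section GramForm.
Variables (R : realType) (n m : nat) (Q : 'M[R]_(n, m)).
Implicit Types u v w : 'rV[R]_n.

Lemma gramDl u v w : gram Q (u + v) w = gram Q u w + gram Q v w.
Proof.
by rewrite /gram -big_split; apply: eq_bigr => j _; rewrite mulmxDl mxE mulrDl.
Qed.

Lemma gram_ge0 v : 0 <= gram Q v v.
Proof. by apply: sumr_ge0 => j _; rewrite -expr2 sqr_ge0. Qed.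

Lemma gram_le : exists2 C, 0 < C & forall v w, `|gram Q v w| <= C * (`|v| * `|w|).
Proof.
have [C C0 QC] := norm_mulmx_le Q.
(* [m.+1] keeps the constant positive when m = 0. *)
exists (C ^+ 2 *+ m.+1); first by rewrite pmulrn_lgt0// exprn_gt0.
move=> v w; rewrite (le_trans (ler_norm_sum _ _ _))//.
apply: (@le_trans _ _ (\sum_(j < m) C ^+ 2 * (`|v| * `|w|))).
  apply: ler_sum => j _; rewrite normrM expr2 mulrACA.
  by rewrite ler_pM// (le_trans (row_coord_le _ _)).
rewrite sumr_const card_ord -mulrnAl ler_wpM2r ?mulr_ge0//.
by rewrite mulrS lerDr exprn_ge0// ltW.
Qed.

(** A right inverse B of Q recovers v from [v *m Q], so |v| is at most a constant times the maximum
    norm of [v *m Q], whose square is at most the sum of squares. *)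
Lemma gram_ge : row_free Q ->
  exists2 c, 0 < c & forall v, c * `|v| ^+ 2 <= gram Q v v.
Proof.
move=> /row_freeP[B QB]; have [C C0 BC] := norm_mulmx_le B.
exists (C ^- 2); first by rewrite invr_gt0 exprn_gt0.
move=> v; rewrite mulrC ler_pdivrMr ?exprn_gt0//.
have [->|v0] := eqVneq v 0;
  first by rewrite normr0 expr0n mulr_ge0 ?gram_ge0 ?exprn_ge0 ?ltW.
have vB : `|v| <= C * `|v *m Q| by have := BC (v *m Q); rewrite -mulmxA QB mulmx1.
apply: (@le_trans _ _ ((C * `|v *m Q|) ^+ 2)); first by rewrite lerXn2r ?nnegrE//
  mulr_ge0// ltW.
rewrite exprMn mulrC ler_wpM2r ?exprn_ge0 ?(ltW C0)//.
have N0 : 0 <= `|v *m Q| by [].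
rewrite -[leRHS]sqr_sqrtr ?gram_ge0// lerXn2r ?nnegrE ?sqrtr_ge0//.
apply: row_norm_le => [|j]; first exact: sqrtr_ge0.
rewrite -sqrtr_sqr ler_sqrt ?gram_ge0// /gram (bigD1 j)//= -expr2 lerDl.
by apply: sumr_ge0 => k _; rewrite -expr2 sqr_ge0.
Qed.

Lemma continuous_mulmx_coord j : continuous (fun v => (v *m Q) 0 j).
Proof.
move=> v; have -> : (fun w => (w *m Q) 0 j) = \sum_i (fun w : 'rV[R]_n =>
  w 0 i * Q i j).
  by apply/funext => w; rewrite mxE fct_sumE.
elim/big_ind : _ => [|g h gc hc|i _]; first exact: cst_continuous.
  exact: continuousD.
by apply: continuousM; [exact: coord_continuous | exact: cst_continuous].
Qed.

Lemma continuous_gram : continuous (fun v => gram Q v v).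
Proof.
move=> v; have -> : (fun w => gram Q w w) = \sum_j (fun w : 'rV[R]_n => (w *m Q)
  0 j * (w *m Q) 0 j).
  by apply/funext => w; rewrite fct_sumE.
elim/big_ind : _ => [|g h gc hc|i _]; first exact: cst_continuous.
  exact: continuousD.
by apply: continuousM; exact: continuous_mulmx_coord.
Qed.

Lemma is_derive_gram (y : R -> 'rV[R]_n) (t : R) dy : is_derive t 1 y dy ->
  is_derive t 1 (fun s => gram Q (y s) (y s)) (2 * gram Q dy (y t)).
Proof.
move=> /is_derive_rowP yd.
have yQ j : is_derive t 1 (fun s => (y s *m Q) 0 j) ((dy *m Q) 0 j).
  have -> : (fun s => (y s *m Q) 0 j) = \sum_i (Q i j \*: (fun s => y s 0 i)).
    by apply/funext => s; rewrite mxE fct_sumE; apply: eq_bigr => i _; rewrite /= mulrC.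
  apply: is_derive_eq; rewrite mxE; apply: eq_bigr => i _.
  by rewrite mulrC.
have -> : (fun s => gram Q (y s) (y s)) =
    \sum_j ((fun s => (y s *m Q) 0 j) * (fun s => (y s *m Q) 0 j)).
  by apply/funext => s; rewrite fct_sumE.
apply: is_derive_eq; rewrite /gram mulr_sumr; apply: eq_bigr => j _.
by rewrite /GRing.scale /=; ring.
Qed.
End GramForm.

Section LocalLipschitz.
Variables (R : realType) (n : nat).
Local Notation E := 'rV[R]_n.

(** Continuity of the derivative is given one direction at a time, so the differential is bounded by
    B, the sum of the norms of the partial derivatives, which is continuous at z0. On a ball where B
    < B z0 + 1, the mean value inequality along segments yields the Lipschitz constant B z0 + 1. *)
Lemma C1_locally_lipschitz (A : set (E * R)) (F : E * R -> E) z0 :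
  open A -> A z0 -> (forall z, A z -> differentiable F z) ->
  (forall v z, A z -> {for z, continuous ('D_v F)}) ->
  exists rho L : R, [/\ 0 < rho, 0 <= L, ball z0 rho `<=` A &
    forall z w, ball z0 rho z -> ball z0 rho w -> `|F z - F w| <= L * `|z - w|].
Proof.
move=> oA Az0 dF cF.
pose e i : E * R := (delta_mx 0 i, 0); pose e' : E * R := (0, 1).
pose B z := \sum_i `|'D_(e i) F z| + `|'D_e' F z|.
have B0 z : 0 <= B z by rewrite addr_ge0// sumr_ge0.
have BE z v : A z -> `|'d F z v| <= B z * `|v|.
  move=> Az; case: v => v a.
  have -> : 'd F z (v, a) = 'd F z (\sum_i v 0 i *: e i + a *: e').
    congr ('d F z _); rewrite (_ : \sum_i _ = (v, 0)).
      by congr (_, _); rewrite /= ?scaler0 ?addr0// add0r [_ *: _]mulr1.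
    rewrite [in RHS](row_sum_delta v).
    by elim/big_ind2 : _ => // [x y u w -> -> |i _]; congr (_, _) => /=;
      rewrite ?addr0// [_ *: _]mulr0.
  rewrite linearD linear_sum linearZ /=.
  have va : `|v| <= `|(v, a)| /\ `|a| <= `|(v, a)|.
    by rewrite [`|(v, a)|]prod_normE /= !le_max !lexx orbT.
  apply: (le_trans (ler_normD _ _)).
  rewrite /B mulrDl lerD//.
    apply: (le_trans (ler_norm_sum _ _ _)).
    rewrite mulr_suml ler_sum// => i _; rewrite linearZ /= normrZ mulrC -deriveE;
      last exact: dF.
    by rewrite ler_wpM2l// (le_trans (row_coord_le _ _))// va.1.
  by rewrite normrZ mulrC -deriveE; [rewrite ler_wpM2l// va.2 | exact: dF].
have Bc : {for z0, continuous B}.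
  apply: continuousD; last by apply: continuous_comp; [exact: cF | exact:
    norm_continuous].
  rewrite (_ : (fun z => _) = \sum_i (fun z => `|'D_(e i) F z|)); last first.
    by apply/funext => z; rewrite fct_sumE.
  elim/big_ind : _ => [|g h gc hc|i _]; first exact: cst_continuous.
    exact: continuousD.
  by apply: continuous_comp; [exact: cF | exact: norm_continuous].
have : \forall z \near z0, A z /\ B z < B z0 + 1.
  near=> z; split; first by near: z; exact: open_nbhs_nbhs.
  near: z; apply: (cvgr_lt _ Bc); lra.
move=> /nbhs_ballP[rho /= rho0 rhoP].
exists rho, (B z0 + 1); split => //; first by rewrite addr_ge0.
  by move=> z /rhoP[].
move=> z w zb wb.
pose ell (s : R) := s *: (z - w) + w.
have ellb s : 0 <= s <= 1 -> ball z0 rho (ell s).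
  move=> /andP[s0 s1]; move: zb wb; rewrite -!ball_normE /ball_ /= => zb wb.
  have -> : z0 - ell s = s *: (z0 - z) + (1 - s) *: (z0 - w).
    rewrite /ell opprD addrCA (_ : z - w = (z0 - w) - (z0 - z)); last first.
      by rewrite opprB [RHS]addrC addrA subrK.
    move: (z0 - w) (z0 - z) => p q.
    by rewrite scalerBr scalerBl scale1r opprB -addrA [- _ + p]addrC.
  apply: (le_lt_trans (ler_normD _ _)); rewrite !normrZ (ger0_norm s0)
    ger0_norm ?subr_ge0//.
  have [->|s0'] := eqVneq s 0; first by rewrite mul0r subr0 add0r mul1r.
  have sp : 0 < s by rewrite lt_neqAle eq_sym s0'.
  have := ltr_pM2l sp `|z0 - z| rho; rewrite zb => H1.
  have : (1 - s) * `|z0 - w| <= (1 - s) * rho by rewrite ler_wpM2l ?subr_ge0// ltW.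
  by move: H1; lra.
have ed (s : R) : 0 <= s <= 1 -> is_derive s (1 : R) (F \o ell) ('d F (ell s) (z - w)).
  move=> /ellb/rhoP[As _]; have dFs := dF _ As.
  have Fd : derivable F (ell s) (z - w) by exact: diff_derivable.
  rewrite -(deriveE _ dFs).
  have E : (fun h : R => h^-1 *: ((F \o ell) (h *: (1 : R) + s) - (F \o ell) s)) =
           (fun h : R => h^-1 *: (F (h *: (z - w) + ell s) - F (ell s))).
    by apply/funext => h; rewrite /= /ell [h%:A]mulr1 scalerDl addrA.
  by apply: DeriveDef; [rewrite /derivable E | rewrite /derive E].
have := @mean_value_ineq R n (F \o ell) (fun s => 'd F (ell s) (z - w))
  0 1 ((B z0 + 1) * `|z - w|) ler01.
rewrite /= /ell scale1r scale0r subrK add0r subr0 mulr1; apply.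
- by move=> t /andP[t0 t1]; apply: ed; rewrite !ltW.
- apply: continuous_in_subspaceT => t; rewrite inE /= in_itv /= => t01.
  exact: is_derive_continuous (ed t t01).
- move=> t /andP[t0 t1]; have /ellb/rhoP[At Bt] : 0 <= t <= 1 by rewrite !ltW.
  by apply: (le_trans (BE _ _ At)); rewrite ler_wpM2r// ltW.
Unshelve. all: by end_near. Qed.
End LocalLipschitz.

(** * Picard iteration *)

Section Picard.
Variables (R : realType) (n : nat).
Local Notation E := 'rV[R]_n.

Definition clamp (a d t : R) := Num.max (a - d) (Num.min (a + d) t).

Lemma clamp_near a d t : 0 <= d -> `|clamp a d t - a| <= d.
Proof.
move=> d0; rewrite ler_norml /clamp /Num.max /Num.min.
by case: (ltP (a + d) t) => ?; case: ltP => ?; lra.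
Qed.

Lemma clamp_id a d t : `|t - a| <= d -> clamp a d t = t.
Proof.
rewrite ler_norml /clamp /Num.max /Num.min => /andP[? ?].
by case: (ltP (a + d) t) => ?; case: ltP => ?; lra.
Qed.

Lemma clamp_lip a d s t : 0 <= d -> `|clamp a d t - clamp a d s| <= `|t - s|.
Proof.
move=> d0; rewrite /clamp /Num.max /Num.min.
have H u v : u <= `|v| -> - u <= `|v| ->
  `|u| <= `|v| :> R by rewrite ler_norml lerNl => -> ->.
have := ler_norm (t - s); have := ler_norm (s - t); rewrite distrC => ? ?.
case: (ltP (a + d) t) => ?; case: (ltP (a - d)) => ?;
  case: (ltP (a + d) s) => ?; case: (ltP (a - d)) => ?; apply: H; lra.
Qed.

Lemma lipschitz_continuous (V W : normedModType R) (L : R) (B : set V) (F : V ->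
  W) (g : R -> V) :
  0 <= L -> (forall z w, B z -> B w -> `|F z - F w| <= L * `|z - w|) ->
  (forall t, B (g t)) -> continuous g -> continuous (F \o g).
Proof.
move=> L0 FL gB gc t; apply/cvgrPdist_lt => e e0.
have e1 : 0 < e / (L + 1) by rewrite divr_gt0// ltr_wpDl.
near=> s.
have gs : `|g t - g s| < e / (L + 1).
  by near: s; move/cvgrPdist_lt: (gc t); apply.
apply: (le_lt_trans (FL _ _ (gB t) (gB s))).
move: gs; rewrite ltr_pdivlMr ?ltr_wpDl//; have := normr_ge0 (g t - g s); nra.
Unshelve. all: by end_near. Qed.

Lemma continuous_clamp a d : 0 <= d -> continuous (clamp a d).
Proof.
move=> d0.
apply: (@lipschitz_continuous _ _ 1 setT (clamp a d) id) => // [z w _ _|t].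
  by rewrite mul1r clamp_lip.
exact: cvg_id.
Qed.

Lemma exists_div_exp2_lt (D e : R) : 0 <= D -> 0 < e -> exists k, D / 2 ^+ k < e.
Proof.
move=> D0 e0; exists (Num.bound (D / e)).
rewrite ltr_pdivrMr ?exprn_gt0// mulrC -ltr_pdivrMr//.
apply: (lt_trans (archi_boundP (divr_ge0 D0 (ltW e0)))).
by rewrite -natrX ltr_nat ltn_expl.
Qed.

(** The explicit rate matters: used at every t with the same D, it makes pointwise limits uniform
    and replaces completeness of a function space. *)
Lemma geometric_cauchy (u : nat -> E) (D : R) :
  (forall k, `|u k.+1 - u k| <= D / 2 ^+ k) ->
  exists l, forall k, `|u k - l| <= 2 * D / 2 ^+ k.
Proof.
move=> uD; have D0 : 0 <= D by have := uD 0%N; rewrite expr0 divr1; apply: le_trans.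
(* The subtracted term is what lets the telescoping induction close. *)
have step k m : `|u (k + m)%N - u k| <= 2 * D / 2 ^+ k - 2 * D / 2 ^+ (k + m).
  elim: m => [|m IH]; first by rewrite addn0 !subrr normr0.
  rewrite addnS -(subrKA (u (k + m)%N)) (le_trans (ler_normD _ _))//.
  have := uD (k + m)%N; rewrite exprS.
  have p0 : 2 ^+ (k + m) != 0 :> R by rewrite expf_neq0.
  have -> : 2 * D / (2 * 2 ^+ (k + m)) = D / 2 ^+ (k + m) by field.
  by rewrite -mulrA in IH *; lra.
have bnd k m : `|u (k + m)%N - u k| <= 2 * D / 2 ^+ k.
  by apply: (le_trans (step k m)); rewrite gerBl divr_ge0// ?mulr_ge0// exprn_ge0.
have small e : 0 < e -> exists k, 2 * D / 2 ^+ k < e.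
  by apply: exists_div_exp2_lt; rewrite mulr_ge0.
have uc : cvg (u @ \oo).
  apply/cauchy_cvgP/cauchy_exP => e e0; have [k ke] := small e e0.
  exists (u k); exists k => // m /= km.
  rewrite -ball_normE /ball_ /= distrC -(subnKC km).
  exact: le_lt_trans (bnd _ _) ke.
exists (limn u) => k; rewrite distrC; apply/ler_addgt0Pl => e e0.
have /cvgrPdist_lt/(_ e e0)[N _ NP] := uc.
have := NP (k + N)%N (leq_addl _ _) => /= H.
rewrite -(subrKA (u (k + N)%N)) (le_trans (ler_normD _ _))// lerD//; exact: ltW.
Qed.

Section Iteration.
Variables (G : R -> E -> E) (M L t0 delta : R) (x0 : E).
Hypothesis Gc : forall y, continuous y -> continuous (fun t => G t (y t)).
Hypothesis L0 : 0 <= L.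
Hypothesis GL : forall t u v, `|G t u - G t v| <= L * `|u - v|.
Hypothesis GM : forall t u, `|G t u| <= M.
Hypothesis delta0 : 0 < delta.
Hypothesis Ld : L * delta <= 1 / 2.

(** z is the Picard integral of y, described by its initial value and its derivative. Stated as an
    implication, the relation can be met for every y, so choice yields a total operator. *)
Let picard_image (y z : R -> E) := continuous y ->
  [/\ continuous z, z t0 = x0,
      forall t, `|t - t0| < delta -> is_derive t 1 z (G t (y t)) &
      forall t, z t = z (clamp t0 delta t)].

(* Clamping the time makes the iterates functions on the whole line, so that the
   contraction estimates are uniform in t. *)
Let picard_op : {P : (R -> E) -> R -> E & forall y, picard_image y (P y)}.
Proof.
apply: (@choice _ _ picard_image) => y; rewrite /picard_image.
have [yc|] := pselect (continuous y); last by exists y.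
have d0 := ltW delta0.
(* The interval is doubled so that every clamped time, end points included, is interior to it. *)
have [H HP] := @antiderivative_row R n _ (t0 - 2 * delta) (t0 + 2 * delta) (Gc yc).
have t0P : clamp t0 delta t0 = t0 by rewrite clamp_id// subrr normr0.
exists (fun t => x0 + (H (clamp t0 delta t) - H t0)) => _; split.
- move=> t; apply: cvgD; first exact: cvg_cst.
  apply: cvgB; last exact: cvg_cst.
  apply: (@continuous_comp _ _ _ (clamp t0 delta) H); first exact: continuous_clamp.
  have := clamp_near t0 t d0; rewrite ler_norml; move: (clamp t0 delta t) =>
    c /andP[c1 c2].
  apply: is_derive_continuous (HP c _).
  have d1 := delta0; apply/andP; split; lra.
- by rewrite t0P subrr addr0.
- move=> t td.
  have near_t : \forall s \near t, x0 + (H s - H t0) = x0 + (H (clamp t0 delta s)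
    - H t0).
    have : (fun s => `|s - t0|) @ t --> `|t - t0|.
      by apply: cvg_norm; apply: cvgB; [exact: cvg_id | exact: cvg_cst].
    move=> /cvgr_lt/(_ _ td); apply: filterS => s sd.
    by rewrite clamp_id// ltW.
  apply: (near_eq_is_derive near_t).
  have HP' : is_derive t 1 H (G t (y t)).
    by apply: HP; move: td; rewrite ltr_norml => /andP[? ?]; have d1 := delta0;
      apply/andP; split; lra.
  rewrite -[G t (y t)]add0r -[G t (y t)]subr0.
  apply: (@is_deriveD _ _ _ (cst x0) (fun s => H s - H t0)).
- by move=> t; rewrite (@clamp_id _ _ (clamp t0 delta t))// clamp_near.
Qed.

Let P := projT1 picard_op.
Let PP y : picard_image y (P y) := projT2 picard_op y.

Let picard_bound (z1 z2 : R -> E) (g : R -> E) K : 0 <= K ->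
  continuous z1 -> continuous z2 -> z1 t0 = z2 t0 ->
  (forall t, `|t - t0| < delta -> is_derive t 1 (z1 - z2) (g t)) ->
  (forall t, `|g t| <= K) ->
  forall t, `|t - t0| <= delta -> `|z1 t - z2 t| <= K * delta.
Proof.
move=> K0 z1c z2c z12 zd gK t td.
have zc a b : {within `[a, b], continuous (z1 - z2)}.
  by apply: continuous_subspaceT => s; apply: continuousB; [exact: z1c | exact: z2c].
have z0 : (z1 - z2) t0 = 0 by rewrite /= /GRing.add /= /GRing.opp /= z12 subrr.
have zt : (z1 - z2) t = z1 t - z2 t by [].
have [tt0|tt0] := leP t0 t.
  have := @mean_value_ineq R n (z1 - z2) g t0 t K tt0; rewrite z0 subr0 zt => H.
  apply: le_trans (H _ (zc _ _) _) _ => //.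
    by move=> s ?; apply: zd; move: td; rewrite ler_norml ltr_norml; lra.
  by rewrite ler_wpM2l//; move: td; rewrite ler_norml; lra.
have := @mean_value_ineq R n (z1 - z2) g t t0 K (ltW tt0);
  rewrite z0 sub0r normrN zt => H.
apply: le_trans (H _ (zc _ _) _) _ => //.
  by move=> s ?; apply: zd; move: td; rewrite ler_norml ltr_norml; lra.
by rewrite ler_wpM2l//; move: td; rewrite ler_norml; lra.
Qed.

(** The factor 1/2 is the bound on [L * delta]. The estimate holds for all t because both images are
    determined by their values at clamped times. *)
Let picard_contraction y z K : continuous y -> continuous z -> 0 <= K ->
  (forall t, `|y t - z t| <= K) -> forall t, `|P y t - P z t| <= K / 2.
Proof.
move=> yc zc K0 yzK t.
have [Pyc Py0 Pyd ->] := PP yc; have [Pzc Pz0 Pzd ->] := PP zc.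
apply: (@le_trans _ _ (L * K * delta)); last first.
  by rewrite mulrAC mulrC ler_wpM2l// -[2^-1]mul1r.
apply: (@picard_bound (P y) (P z) (fun t => G t (y t) - G t (z t))) => //.
- by rewrite mulr_ge0.
- by rewrite Py0 Pz0.
- by move=> s sd; apply: is_deriveB; [exact: Pyd | exact: Pzd].
- by move=> s; apply: (le_trans (GL _ _ _)); rewrite ler_wpM2l.
- by rewrite clamp_near// ltW.
Qed.

(** Iterating from the constant x0, successive differences halve uniformly in t, so the limit x is
    continuous. The contraction puts [P x] arbitrarily close to the iterates, hence [P x = x]. *)
Lemma picard_solution : exists y : R -> E, y t0 = x0 /\
  forall t, `|t - t0| < delta -> is_derive t 1 y (G t (y t)).
Proof.
have M0 : 0 <= M by apply: le_trans (GM t0 x0).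
pose y k := iter k P (cst x0).
have yc k : continuous (y k).
  by elim: k => [|k IH]; [exact: cst_continuous | have [] := PP IH].
pose D := M * delta.
have D0 : 0 <= D by rewrite mulr_ge0// ltW.
have yD k t : `|y k.+1 t - y k t| <= D / 2 ^+ k.
  elim: k t => [|k IH] t.
    rewrite expr0 divr1; have [Pyc Py0 Pyd E] := PP (yc 0%N).
    rewrite /y /= [P _ t]E.
    apply: (@picard_bound (P (cst x0)) (cst x0) (fun t => G t x0)) => //.
    - exact: (yc 0%N).
    - by move=> s sd; rewrite -[G s x0]subr0; apply: is_deriveB; exact: Pyd.
    - by rewrite clamp_near// ltW.
  rewrite exprSr invfM mulrA.
  by apply: (picard_contraction (yc k.+1) (yc k)) => //; rewrite divr_ge0// exprn_ge0.
have /choice[x xP] : forall t, exists l, forall k, `|y k t - l| <= 2 * D / 2 ^+ k.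
  by move=> t; apply: geometric_cauchy => k; exact: yD.
have small e : 0 < e -> exists k, 2 * D / 2 ^+ k < e.
  by apply: exists_div_exp2_lt; rewrite mulr_ge0.
have xc : continuous x.
  move=> t; apply/cvgrPdist_lt => e e0.
  have [k ke] := small (e / 3) ltac:(by rewrite divr_gt0).
  near=> s.
  have yts : `|y k t - y k s| < e / 3.
    by near: s; move/cvgrPdist_lt: (yc k t); apply; rewrite divr_gt0.
  have := xP s k; have := xP t k; rewrite distrC => h1 h2.
  rewrite -(subrKA (y k t)) (le_lt_trans (ler_normD _ _))//.
  have : `|y k t - x s| <= `|y k t - y k s| + `|y k s - x s|.
    by rewrite -(subrKA (y k s)) ler_normD.
  lra.
have [Pc P0 Pd _] := PP xc.
have Px : P x = x.
  apply/funext => t; apply/eqP; rewrite -subr_eq0 -normr_eq0 eq_le normr_ge0 andbT.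
  apply/ler_addgt0Pl => e e0; rewrite addr0.
  have [k ke] := small (e / 2) ltac:(by rewrite divr_gt0).
  have K0 : 0 <= 2 * D / 2 ^+ k by apply: divr_ge0; [exact: mulr_ge0 | exact:
    exprn_ge0].
  have h1 : `|P x t - y k.+1 t| <= 2 * D / 2 ^+ k / 2.
    apply: picard_contraction => // s.
    by rewrite distrC; exact: xP.
  have h2 := xP t k.+1.
  have h3 : 2 * D / 2 ^+ k.+1 = 2 * D / 2 ^+ k / 2 by rewrite exprSr invfM mulrA.
  rewrite -(subrKA (y k.+1 t)) (le_trans (ler_normD _ _))//; rewrite h3 in h2; lra.
by exists x; split; [rewrite -Px | move=> t td; rewrite -{1}Px; exact: Pd].
Unshelve. all: by end_near. Qed.
End Iteration.
End Picard.

(** * Local solutions *)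

Section LocallyLipschitzODE.
Variables (R : realType) (n : nat).
Local Notation E := 'rV[R]_n.
Variables (U : set E) (f : E -> R -> E).

(** The estimate is joint in state and parameter, because two solutions are compared whose
    parameters differ as well. *)
Definition locally_lipschitz := forall p lam, U p -> exists rho L : R,
  [/\ 0 < rho, 0 <= L, forall q, `|q - p| < rho -> U q &
      forall q q' m m', `|q - p| < rho -> `|q' - p| < rho ->
        `|m - lam| < rho -> `|m' - lam| < rho ->
        `|f q m - f q' m'| <= L * (`|q - q'| + `|m - m'|)].

Lemma C2_locally_lipschitz : open U ->
  Ck_on 2 (U `*` [set: R]) (fun z : E * R => f z.1 z.2) -> locally_lipschitz.
Proof.
move=> oU [dF C1F] p lam Up.
have oA : open (U `*` [set: R]).
  rewrite openE => -[q m] [Uq _]; exists (U, setT) => /=; last by move=> z [? _]; split.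
  by split; [exact: open_nbhs_nbhs | exact: filterT].
have cF v z : (U `*` [set: R]) z ->
    {for z, continuous ('D_v (fun z : E * R => f z.1 z.2))}.
  by move=> Az; apply/differentiable_continuous; have [+ _] := C1F v; apply.
have [|rho [L [rho0 L0 AU FL]]] := @C1_locally_lipschitz _ _ _ _ (p, lam) oA _ dF cF.
  by split.
have ballE q m : `|q - p| < rho -> `|m - lam| < rho -> ball (p, lam) rho (q, m).
  by move=> qp ml; rewrite -ball_normE /ball_ /= prod_normE /= gt_max distrC qp distrC.
exists rho, L; split => //.
  move=> q qp; have [] : (U `*` [set: R]) (q, lam); last by [].
  by apply/AU/ballE => //; rewrite subrr normr0.
move=> q q' m m' qp q'p ml m'l.
apply: (le_trans (FL (q, m) (q', m') (ballE _ _ qp ml) (ballE _ _ q'p m'l))).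
rewrite ler_wpM2l// prod_normE /= ge_max.
by rewrite lerDl lerDr !normr_ge0.
Qed.

Definition clamp_row (p : E) (d : R) (u : E) : E := \row_i clamp (p 0 i) d (u 0 i).

Lemma clamp_row_near p d u : 0 <= d -> `|clamp_row p d u - p| <= d.
Proof. by move=> d0; apply: row_norm_le => // i; rewrite !mxE clamp_near. Qed.

Lemma clamp_row_id p d u : `|u - p| <= d -> clamp_row p d u = u.
Proof.
move=> ud; apply/rowP => i; rewrite mxE clamp_id//.
by apply: le_trans ud; apply: le_trans (row_coord_le _ i); rewrite !mxE.
Qed.

Lemma clamp_row_lip p d u v : 0 <= d ->
  `|clamp_row p d u - clamp_row p d v| <= `|u - v|.
Proof.
move=> d0; apply: row_norm_le => // i; rewrite !mxE.
by apply: (le_trans (clamp_lip _ _ _ d0)); apply: le_trans (row_coord_le _ i);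
  rewrite !mxE.
Qed.

Hypothesis f_lip : locally_lipschitz.

(* The field is replaced outside a ball around p by its value at the coordinatewise
   clamped point, which keeps it globally Lipschitz and bounded. *)
Lemma local_solution (lam : R -> R) (T : R) (p : E) : continuous lam -> U p ->
  exists d (y : R -> E), [/\ 0 < d, y T = p &
    forall t, `|t - T| < d -> U (y t) /\ is_derive t 1 y (f (y t) (lam t))].
Proof.
move=> lamc Up; have [rho [L [rho0 L0 UP fL]]] := f_lip (lam T) Up.
have [d0 d00 lamd] : exists2 d0 : R, 0 < d0 & forall t, `|t - T| <= d0 ->
  `|lam t - lam T| < rho.
  have /cvgrPdist_lt/(_ _ rho0)/nbhs_ballP[e /= e0 eP] := lamc T.
  exists (e / 2); first by rewrite divr_gt0.
  move=> t tT; rewrite distrC; apply: eP; rewrite -ball_normE /ball_ /= distrC.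
  by rewrite (le_lt_trans tT)// ltr_pdivrMr// mulr2n mulrDr mulr1 ltrDl.
(* Clamped points fill a closed ball of radius r, which has to lie inside the open ball of radius
   rho. *)
pose r := rho / 2; have r0 : 0 < r by rewrite divr_gt0.
have rr : r < rho by rewrite /r; lra.
pose G t u := f (clamp_row p r u) (lam (clamp T d0 t)).
have near_p u : `|clamp_row p r u - p| < rho.
  by apply: le_lt_trans rr; apply: clamp_row_near; exact: ltW.
have near_lam t : `|lam (clamp T d0 t) - lam T| < rho.
  by apply: lamd; apply: clamp_near; exact: ltW.
have GL t u v : `|G t u - G t v| <= L * `|u - v|.
  apply: (le_trans (fL _ _ _ _ (near_p u) (near_p v) (near_lam t) (near_lam t))).
  by rewrite subrr normr0 addr0 ler_wpM2l// clamp_row_lip// ltW.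
pose M := `|f p (lam T)| + L * (rho + rho).
have M0 : 0 <= M by rewrite addr_ge0// mulr_ge0// addr_ge0// ltW.
have GM t u : `|G t u| <= M.
  rewrite -[G t u](subrK (f p (lam T))) (le_trans (ler_normD _ _))// addrC lerD2l.
  apply: (le_trans (fL _ _ _ _ (near_p u) _ (near_lam t) _)); rewrite ?subrr ?normr0//.
  by rewrite ler_wpM2l// lerD// ltW.
have Gc y : continuous y -> continuous (fun t => G t (y t)).
  move=> yc; pose B : set (E * R) := [set z | `|z.1 - p| < rho /\ `|z.2 - lam T| < rho].
  apply: (@lipschitz_continuous R _ _ (2 * L) B (fun z : E * R => f z.1 z.2)
    (fun t => (clamp_row p r (y t), lam (clamp T d0 t)))).
  - by rewrite mulr_ge0.
  - move=> [q m] [q' m'] /= [qp ml] [q'p m'l].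
    apply: (le_trans (fL _ _ _ _ qp q'p ml m'l)).
    rewrite [2 * L]mulrC -mulrA ler_wpM2l// mulr_natl mulr2n prod_normE /=.
    by rewrite lerD// le_max lexx ?orbT.
  - by move=> t; split; [exact: near_p | exact: near_lam].
  - have rowc : continuous (clamp_row p r \o y).
      apply: (@lipschitz_continuous R _ _ 1 setT) => // u v _ _.
      by rewrite mul1r; apply: clamp_row_lip; exact: ltW.
    have lc : continuous (lam \o clamp T d0).
      move=> t; apply: continuous_comp; last exact: lamc.
      exact/continuous_clamp/ltW.
    by move=> t; exact: (cvg_pair (rowc t) (lc t)).
(* [d <= d0] makes the clamping of time inactive, the second bound gives the contraction, and the
   third gives [M * d <= r], so that the clamping of the state is inactive along the solution.
   Adding 1 avoids zero denominators. *)
pose d := Num.min d0 (Num.min (1 / (2 * (L + 1))) (r / (M + 1))).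
have dd : [/\ 0 < d, d <= d0, d <= 1 / (2 * (L + 1)) & d <= r / (M + 1)].
  split; rewrite /d ?ge_min ?lexx ?orbT//.
  by rewrite !lt_min d00 !divr_gt0 ?mulr_gt0// ltr_wpDl.
case: dd => dpos dd0 dL dM.
have Ld : L * d <= 1 / 2.
  apply: (@le_trans _ _ (L * (1 / (2 * (L + 1))))); first by rewrite ler_wpM2l.
  rewrite mulrA mulr1 ler_pdivrMr ?mulr_gt0 ?ltr_wpDl//; lra.
have [y [yT yd]] := @picard_solution R n G M L T d p Gc L0 GL GM dpos Ld.
have yp t : `|t - T| < d -> `|y t - p| <= r.
  move=> td.
  have Md : M * d <= r.
    have := ler_wpM2l M0 dM; rewrite mulrA [M * r]mulrC -mulrA => H; apply:
      (le_trans H).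
    by rewrite ler_piMr ?(ltW r0)// ler_pdivrMr ?ltr_wpDl// mul1r lerDl.
  have yw a b : T - d < a -> b < T + d -> {within `[a, b], continuous y}.
    move=> ad bd; apply: continuous_in_subspaceT => s; rewrite inE /= in_itv /= =>
      /andP[? ?].
    by apply: is_derive_continuous (yd s _); rewrite ltr_norml; apply/andP; split; lra.
  move: (td); rewrite ltr_norml => /andP[td1 td2].
  have yd' s a b : T - d < a -> b < T + d -> a < s < b -> is_derive s 1 y (G s (y s)).
    by move=> ? ? /andP[? ?]; apply: yd; rewrite ltr_norml; apply/andP; split; lra.
  rewrite -yT; have [Tt|tT] := leP T t.
    apply: (le_trans (@mean_value_ineq R n y (fun s => G s (y s)) T t M Tt _ _ _)).
    - by move=> s; apply: yd'; lra.
    - by apply: yw; lra.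
    - by move=> *; exact: GM.
    - by apply: le_trans Md; rewrite ler_wpM2l//; lra.
  rewrite distrC.
  apply: (le_trans (@mean_value_ineq R n y (fun s => G s (y s)) t T M (ltW tT) _ _ _)).
  - by move=> s; apply: yd'; lra.
  - by apply: yw; lra.
  - by move=> *; exact: GM.
  - by apply: le_trans Md; rewrite ler_wpM2l//; lra.
exists d, y; split => // t td; split.
  by apply: UP; apply: le_lt_trans rr; exact: yp.
have := yd t td; rewrite /G clamp_row_id; last exact: yp.
by rewrite clamp_id// ltW// (lt_le_trans td).
Qed.
End LocallyLipschitzODE.

(** * Dependence on the parameter and Lyapunov stability *)

Section Stability.
Variables (R : realType) (n : nat).
Local Notation E := 'rV[R]_n.
Variables (U : set E) (f : E -> R -> E).
Hypothesis f_lip : locally_lipschitz U f.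

Lemma pinfty_pos_ex (P : R -> Prop) : (\forall K \near +oo, P K) -> exists2 K : R,
  0 < K & P K.
Proof.
move=> PK; have : \forall K \near +oo, 0 < K /\ P K.
  near=> K; split; [by near: K; exact: nbhs_pinfty_gt | by near: K].
by move=> /filter_ex[K [? ?]]; exists K.
Unshelve. all: by end_near. Qed.

(** A single K serves as Lipschitz constant and as inverse radius. Both requirements relax as K
    grows, so the local estimates combine into one by compactness along the filter at +oo. *)
Lemma lipschitz_near_compact (B : set E) (lam : R) : compact B -> B `<=` U ->
  exists2 K : R, 0 < K & forall p q m, B p ->
    `|q - p| < K^-1 -> `|m - lam| < K^-1 ->
    `|f q m - f p lam| <= K * (`|q - p| + `|m - lam|).
Proof.
move=> cB BU.
pose P (K : R) p := forall q m, `|q - p| < K^-1 -> `|m - lam| < K^-1 ->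
    `|f q m - f p lam| <= K * (`|q - p| + `|m - lam|).
have cov := (compact_near_coveringP B).1 cB.
have : \forall K \near +oo, B `<=` P K.
  apply: cov => p0 Bp0.
  have [rho [L [rho0 L0 UP fL]]] := f_lip lam (BU p0 Bp0).
  near=> p K.
  have pp0 : `|p - p0| < rho / 2.
    near: p; apply/nbhs_ballP; exists (rho / 2); first by rewrite /= divr_gt0.
    by move=> p; rewrite -ball_normE /ball_ /= distrC.
  have K0 : 0 < K by near: K; exact: nbhs_pinfty_gt.
  have KL : L <= K by near: K; apply: nbhs_pinfty_ge; rewrite num_real.
  have Krho : K^-1 < rho / 2.
    have : 2 / rho < K by near: K; apply: nbhs_pinfty_gt; rewrite num_real.
    by rewrite invf_plt ?posrE ?divr_gt0// invf_div.
  move=> q m /= qp ml.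
  have := fL q p m lam; rewrite subrr normr0.
  move=> H; apply: (le_trans (H _ _ _ _)) => //; last by rewrite ler_wpM2r// addr_ge0.
  - rewrite -(subrKA p) (le_lt_trans (ler_normD _ _))//; lra.
  - lra.
by move=> /pinfty_pos_ex[K K0 KP]; exists K => // p q m Bp; exact: KP.
Unshelve. all: by end_near. Qed.

Lemma bounded_near_compact (B : set E) (lam : R) : compact B -> B `<=` U ->
  exists2 K : R, 0 < K & forall q m, B q -> `|m - lam| < K^-1 -> `|f q m| <= K.
Proof.
move=> cB BU.
pose P (K : R) q := forall m, `|m - lam| < K^-1 -> `|f q m| <= K.
have cov := (compact_near_coveringP B).1 cB.
have : \forall K \near +oo, B `<=` P K.
  apply: cov => p0 Bp0.
  have [rho [L [rho0 L0 UP fL]]] := f_lip lam (BU p0 Bp0).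
  near=> p K.
  have pp0 : `|p - p0| < rho.
    near: p; apply/nbhs_ballP; exists rho => //= p.
    by rewrite -ball_normE /ball_ /= distrC.
  have K0 : 0 < K by near: K; exact: nbhs_pinfty_gt.
  have KL : `|f p0 lam| + L * (rho + rho) <= K.
    by near: K; apply: nbhs_pinfty_ge; rewrite num_real.
  have Krho : K^-1 < rho.
    have : rho^-1 < K by near: K; apply: nbhs_pinfty_gt; rewrite num_real.
    by rewrite invf_plt ?posrE ?invr_gt0// invrK.
  move=> m /= ml; apply: le_trans KL.
  rewrite -[f p m](subrK (f p0 lam)) (le_trans (ler_normD _ _))// addrC lerD2l.
  apply: (le_trans (fL _ _ _ _ pp0 _ _ _)); rewrite ?subrr ?normr0//; first lra.
  by rewrite ler_wpM2l// lerD//; lra.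
by move=> /pinfty_pos_ex[K K0 KP]; exists K => // q m Bq; exact: KP.
Unshelve. all: by end_near. Qed.

(* The differential inequality is available only below the level c, which the
   conclusion shows is never reached. *)
Lemma gronwall_barrier (u du : R -> R) (tau A h c : R) : 0 <= tau -> 0 <= A ->
  {within `[0, tau], continuous u} ->
  (forall s, 0 < s < tau -> is_derive s 1 u (du s)) ->
  (forall s, 0 < s < tau -> u s < c -> du s <= A * (u s + h)) ->
  0 <= h -> (u 0 + h) * expR (A * tau) < c -> 0 <= u 0 ->
  u tau <= (u 0 + h) * expR (A * tau).
Proof.
move=> tau0 A0 uc ud duA h0 uhc u0.
(* The integrating factor makes w nonincreasing wherever the differential inequality holds. *)
pose w s := (u s + h) * expR (- (A * s)).
have ed (s : R) : is_derive s 1 (fun s : R => expR (- (A * s)))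
  (- A * expR (- (A * s))).
  have lin : is_derive s 1 (fun s : R => - (A * s)) (- A).
    have := @is_deriveN _ _ _ (A \*: id) s 1 _ (is_deriveZ A (is_derive_id s 1)).
    by rewrite /= [A *: 1]mulr1.
  have := @is_derive1_comp _ expR _ s _ _ (is_derive_expR _) lin.
  by rewrite mulrC.
have wd s : 0 < s < tau -> is_derive s 1 w ((du s - A * (u s + h)) * expR (- (A * s))).
  move=> s0; have uds := ud s s0.
  have := @is_deriveM _ _ (u + cst h)
    _ s 1 _ _ (is_deriveD uds (is_derive_cst h s 1)) (ed s).
  move=> H; apply: (is_derive_eq H).
  change ((u s + h) * (- A * expR (- (A * s))) + expR (- (A * s)) * (du s + 0) =
    (du s - A * (u s + h)) * expR (- (A * s))); ring.
have wc : {within `[0, tau], continuous w}.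
  move=> s; apply: (@continuousM _ (subspace `[0, tau]) (fun s => u s + h)
    (fun s => expR (- (A * s)))).
    by apply: continuousD; [exact: uc | exact: cst_continuous].
  apply: (continuous_subspaceT _) => {}s; exact: is_derive_continuous (ed s).
(* The upper level c exp(-A tau) lies below c exp(-A s), so w under it forces u s < c, where the
   inequality is available. *)
have wd0 s : 0 < s < tau -> w 0 < w s < c * expR (- (A * tau)) ->
    (du s - A * (u s + h)) * expR (- (A * s)) <= 0.
  move=> s0 /andP[_ ws]; rewrite mulr_le0_ge0 ?expR_ge0// subr_le0; apply: duA => //.
  have : w s < c * expR (- (A * s)).
    apply: (lt_le_trans ws); rewrite ler_wpM2l ?ler_expR ?lerN2 ?ler_wpM2l//; last lra.
    by apply: le_trans (ltW uhc); rewrite mulr_ge0 ?expR_ge0// addr_ge0.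
  rewrite ltr_pM2r ?expR_gt0//; lra.
have w0 : w 0 = u 0 + h by rewrite /w mulr0 oppr0 expR0 mulr1.
have wlt : w 0 < c * expR (- (A * tau)).
  by rewrite w0 expRN ltr_pdivlMr ?expR_gt0.
have := barrier wc wd wlt wd0 (lexx _).
move=> /(_ tau); rewrite tau0 lexx => /(_ isT);
  rewrite w0 /w expRN ler_pdivrMr ?expR_gt0//.
lra.
Qed.

(** Gronwall's inequality for a squared Euclidean distance to phi. The Lipschitz estimate around the
    compact arc of phi holds only within distance 1/K, hence the version with a barrier. *)
Lemma continuous_dependence (phi : R -> E) (lam tau e : R) :
  solution_on U (fun _ y => f y lam) `[0, +oo[ phi -> 0 <= tau -> 0 < e ->
  exists2 eta : R, 0 < eta & forall (y : R -> E) (mu : R -> R),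
    {within `[0, tau], continuous y} ->
    (forall s, 0 < s < tau -> is_derive s 1 y (f (y s) (mu s))) ->
    (forall s, 0 < s < tau -> `|mu s - lam| < eta) ->
    `|y 0 - phi 0| < eta -> `|y tau - phi tau| < e.
Proof.
move=> [phic phiU phid] tau0 e0.
have sub : `[0 : R, tau] `<=` `[0 : R, +oo[.
  by move=> s /=; rewrite !in_itv /= => /andP[->].
have phid' s : 0 < s < tau -> is_derive s 1 phi (f (phi s) lam).
  move=> /andP[s0 _]; apply: phid; apply/nbhs_ballP; exists s => //= t.
  rewrite -ball_normE /ball_ /= in_itv /= andbT ltr_norml => /andP[_]; lra.
have phic' : {within `[0, tau], continuous phi} := continuous_subspaceW sub phic.
have cB : compact (phi @` `[0, tau]) by apply: continuous_compact => //; exact: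
  segment_compact.
have BU : phi @` `[0, tau] `<=` U by move=> _ [s As <-]; apply/phiU/sub.
have [K K0 KP] := lipschitz_near_compact lam cB BU.
pose Q : 'M[R]_n := 1%:M.
have [C C0 CP] := gram_le Q.
have [|c c0 cP] := @gram_ge _ _ _ Q; first by rewrite row_free_unit unitmx1.
(* The derivative of u is at most 2CK(|v| + eta)|v|, hence at most 2CK(2|v|^2 + eta^2) with |v|^2 <=
   u / c. A adds the coefficients of u and of eta^2. *)
pose A := 4 * C * K / c + 2 * C * K.
have A0 : 0 <= A by rewrite /A addr_ge0// ?divr_ge0// ?mulr_ge0// ltW.
pose m := Num.min K^-1 e.
have m0 : 0 < m by rewrite lt_min invr_gt0 K0.
pose b := c * m ^+ 2 * expR (- (A * tau)).
have b0 : 0 < b by rewrite !mulr_gt0 ?exprn_gt0 ?expR_gt0.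
(* [eta <= 1] gives eta^2 <= eta, so the initial value u 0 + eta^2 is at most (C + 1) eta <= b /
   2. *)
pose eta := Num.min K^-1 (Num.min 1 (b / (2 * (C + 1)))).
have [eta0 etaK eta1 etab] : [/\ 0 < eta, eta <= K^-1,
  eta <= 1 & eta <= b / (2 * (C + 1))].
  split; rewrite /eta ?ge_min ?lexx ?orbT//.
  by rewrite !lt_min invr_gt0 K0 ltr01 divr_gt0// mulr_gt0// addr_gt0.
exists eta => // y mu yc yd mul y0.
pose v s := y s - phi s.
pose dv s := f (y s) (mu s) - f (phi s) lam.
have vd s : 0 < s < tau -> is_derive s 1 v (dv s).
  by move=> s0; have := yd s s0; have := phid' s s0 => ? ?; exact: is_deriveB.
have vc : {within `[0, tau], continuous v}.
  by move=> s; apply: continuousB; [exact: yc | exact: phic'].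
pose u s := gram Q (v s) (v s).
have uc : {within `[0, tau], continuous u}.
  exact: (within_comp (@continuous_gram _ _ _ Q) vc).
have ud s : 0 < s < tau -> is_derive s 1 u (2 * gram Q (dv s) (v s)).
  by move=> s0; apply: is_derive_gram; exact: vd.
have vlt s r : 0 < r -> u s < c * r ^+ 2 -> `|v s| < r.
  move=> r0 us; have := le_lt_trans (cP (v s)) us.
  by rewrite ltr_pM2l// ltr_pXn2r ?nnegrE ?(ltW r0).
have duA s : 0 < s < tau -> u s < c * m ^+ 2 ->
    2 * gram Q (dv s) (v s) <= A * (u s + eta ^+ 2).
  move=> s0 us; have vm := vlt s m m0 us.
  have vK : `|v s| < K^-1 by apply: (lt_le_trans vm); rewrite ge_min lexx.
  have As : `[0, tau]%classic s by rewrite /= in_itv /=; case/andP: s0 => ? ?;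
    rewrite !ltW.
  have dvK := KP (phi s) (y s) (mu s) (ex_intro2 _ _ s As erefl)
    vK (lt_le_trans (mul s s0) etaK).
  have mus := mul s s0.
  have g1 := le_trans (ler_norm _) (CP (dv s) (v s)).
  have cv := cP (v s); rewrite -/(u s) in cv.
  rewrite -/(dv s) -/(v s) in dvK.
  have g2 : `|dv s| * `|v s| <= K * (`|v s| + eta) * `|v s|.
    rewrite ler_wpM2r//; apply: (le_trans dvK); rewrite ler_wpM2l ?(ltW K0)//.
    by rewrite lerD2l ltW.
  have g3 : (`|v s| + eta) * `|v s| <= 2 * `|v s| ^+ 2 + eta ^+ 2.
    by have := sqr_ge0 (`|v s| - eta); have := sqr_ge0 eta; nra.
  have g4 : `|v s| ^+ 2 <= u s / c by rewrite ler_pdivlMr// mulrC.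
  have CK : 0 <= 2 * C * K by rewrite !mulr_ge0 ?ltW.
  have u0 : 0 <= u s := gram_ge0 Q (v s).
  apply: (@le_trans _ _ (2 * C * K * (2 * (u s / c) + eta ^+ 2))).
    apply: (@le_trans _ _ (2 * C * K * ((`|v s| + eta) * `|v s|))).
      apply: (@le_trans _ _ (2 * (C * (`|dv s| * `|v s|)))); first by rewrite ler_wpM2l.
      by have := ler_wpM2l (ltW C0) g2; lra.
    by rewrite ler_wpM2l//; apply: (le_trans g3); rewrite lerD2r ler_wpM2l.
  have -> : A * (u s + eta ^+ 2) = 2 * C * K * (2 * (u s / c) + eta ^+ 2) +
      2 * C * K * u s + 4 * C * K / c * eta ^+ 2 by rewrite /A; ring.
  have t1 : 0 <= 2 * C * K * u s by exact: mulr_ge0.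
  have t2 : 0 <= 4 * C * K / c * eta ^+ 2.
    by rewrite mulr_ge0 ?sqr_ge0// divr_ge0 ?(ltW c0)// !mulr_ge0 ?(ltW C0) ?(ltW K0).
  lra.
have uh : u 0 + eta ^+ 2 < b.
  have h1 := le_trans (ler_norm _) (CP (v 0) (v 0)); rewrite -/(u 0) in h1.
  have h2 : `|v 0| * `|v 0| <= eta ^+ 2 by rewrite expr2 ler_pM// ltW.
  have h3 : eta ^+ 2 <= eta by rewrite expr2 ler_piMr// ltW.
  have h4 : u 0 + eta ^+ 2 <= (C + 1) * eta.
    rewrite mulrDl mul1r lerD// (le_trans h1)// ler_wpM2l ?(ltW C0)//.
    exact: le_trans h3.
  apply: (le_lt_trans h4); apply: (@le_lt_trans _ _ ((C + 1) * (b / (2 * (C + 1))))).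
    by rewrite ler_wpM2l// addr_ge0// ltW.
  have -> : (C + 1) * (b / (2 * (C + 1))) = b / 2.
    by field; rewrite gt_eqF// addr_gt0.
  lra.
have uhc : (u 0 + eta ^+ 2) * expR (A * tau) < c * m ^+ 2.
  by move: uh; rewrite /b expRN ltr_pdivlMr ?expR_gt0.
apply: (@lt_le_trans _ _ m); last by rewrite ge_min lexx orbT.
apply: (vlt tau m m0); apply: le_lt_trans (uhc).
apply: (@gronwall_barrier u _ tau A (eta ^+ 2) (c * m ^+ 2)) => //.
- exact: sqr_ge0.
- exact: gram_ge0.
Qed.

(** The linear part contributes at most -a c |v|^2 = -2 beta |v|^2. The remainder of the
    differential is at most (beta / C) |v| near p, which costs only beta |v|^2. *)
Lemma attracting_gram (lam : R) (p : E) : differentiable (f ^~ lam) p ->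
  attracting_equilibrium U f lam p ->
  exists (Q : 'M[R]_(n, n + n)) (beta rho : R),
    [/\ row_free Q, 0 < beta, 0 < rho &
      forall v, `|v| < rho -> gram Q (f (v + p) lam) v <= - beta * `|v| ^+ 2].
Proof.
move=> df [Up fp0 hJ].
have [Q [a [a0 Qfree Qa]]] := hurwitz_gram hJ.
have [C C0 CP] := gram_le Q.
have [c c0 cP] := gram_ge Qfree.
pose beta := a * c / 2.
have beta0 : 0 < beta by rewrite divr_gt0// mulr_gt0.
have e0 : 0 < beta / C by rewrite divr_gt0.
have /eqaddoP/(_ _ e0) := diff_locally df.
move=> /nbhs_ballP[rho /= rho0 rhoP].
exists Q, beta, rho; split => // v vrho.
have := rhoP v; rewrite -ball_normE /ball_ /= sub0r normrN => /(_ vrho).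
set o := (X in `|X| <= _) => oe.
have -> : f (v + p) lam = v *m jacobian (f ^~ lam) p + o.
  rewrite /jacobian mul_rV_lin1; apply/eqP.
  rewrite -subr_eq0 -[X in _ - X]addrC opprD addrA; apply/eqP.
  have -> : o = f (v + p) lam - (f p lam + 'd (f ^~ lam) p v) by [].
  by rewrite fp0 add0r subKr subrr.
rewrite gramDl.
have h1 := Qa v; have h2 := cP v.
have h3 := le_trans (ler_norm _) (CP o v).
have h4 : C * (`|o| * `|v|) <= beta * `|v| ^+ 2.
  have := ler_wpM2r (normr_ge0 v) oe; rewrite -mulrA -expr2 => h.
  have -> : beta * `|v| ^+ 2 = C * (beta / C * `|v| ^+ 2) by field; rewrite gt_eqF.
  by rewrite ler_wpM2l// ltW.
have h5 : a * (c * `|v| ^+ 2) <= a * gram Q v v by rewrite ler_wpM2l// ltW.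
have -> : - beta * `|v| ^+ 2 = beta * `|v| ^+ 2 - a * (c * `|v| ^+ 2)
  by rewrite /beta; field.
lra.
Qed.

(** A parameter error of size eta costs at most C L eta |v|, which beta |v|^2 absorbs as soon as |v|
    > s. So u cannot grow between the levels C s^2 and c e^2; the ball of radius s lies below the
    lower level, and staying below the upper one keeps |v| < e. *)
Lemma trapping (lam : R) (p : E) e : differentiable (f ^~ lam) p ->
  attracting_equilibrium U f lam p -> 0 < e ->
  exists2 kappa : R, 0 < kappa & exists2 eta : R, 0 < eta &
    forall (x : R -> E) (mu : R -> R) (t1 : R),
      (forall t, t1 <= t -> {for t, continuous x}) ->
      (forall t, t1 <= t -> is_derive t 1 x (f (x t) (mu t))) ->
      (forall t, t1 <= t -> `|mu t - lam| < eta) -> `|x t1 - p| < kappa ->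
      forall t, t1 <= t -> `|x t - p| < e.
Proof.
move=> df att e0.
have [Q [beta [rho [Qfree beta0 rho0 Qb]]]] := attracting_gram df att.
have Up : U p by case: att.
have [rho1 [L [rho10 L0 _ fL]]] := f_lip lam Up.
wlog [erho erho1] : e e0 / e <= rho /\ e <= rho1.
  move=> H; have m0 : 0 < Num.min e (Num.min rho rho1) by rewrite !lt_min e0 rho0.
  have [|kappa k0 [eta eta0 kP]] := H _ m0.
    by split; rewrite !ge_min lexx ?orbT.
  exists kappa => //; exists eta => // x mu t1 xc xd mul xt1 t tt1.
  by apply: lt_le_trans (kP x mu t1 xc xd mul xt1 t tt1) _; rewrite ge_min lexx.
have [C C0 CP] := gram_le Q.
have [c c0 cP] := gram_ge Qfree.
(* With k the minimum, k <= 1 gives k^2 <= k, so C k^2 <= c / 2 and the two levels are separated. *)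
pose s := e * Num.min 1 (c / (2 * C)).
have [s0 se sc] : [/\ 0 < s, s <= e & C * s ^+ 2 < c * e ^+ 2].
  have m0 : 0 < Num.min 1 (c / (2 * C)) by rewrite lt_min ltr01 divr_gt0// mulr_gt0.
  have m1 : Num.min 1 (c / (2 * C)) <= 1 by rewrite ge_min lexx.
  have mc : Num.min 1 (c / (2 * C)) <= c / (2 * C) by rewrite ge_min lexx orbT.
  rewrite /s; move: m0 m1 mc; move: (Num.min _ _) => k k0 k1 kc.
  split; [exact: mulr_gt0 | by rewrite ler_piMr// ltW |].
  have -> : C * (e * k) ^+ 2 = C * k ^+ 2 * e ^+ 2 by ring.
  rewrite ltr_pM2r ?exprn_gt0//.
  have : k ^+ 2 <= k by rewrite expr2 ler_piMr// ltW.
  move: kc; rewrite ler_pdivlMr ?mulr_gt0// => kc k2.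
  have := ler_wpM2l (ltW C0) k2; nra.
pose eta := Num.min rho1 (beta * s / (C * (L + 1))).
have [eta0 etar etab] : [/\ 0 < eta, eta <= rho1 & eta <= beta * s / (C * (L + 1))].
  split; rewrite /eta ?ge_min ?lexx ?orbT// lt_min rho10 divr_gt0// mulr_gt0//.
  by rewrite ltr_wpDl.
exists s => //; exists eta => // x mu t1 xc xd mul xt1 t tt1.
pose v t := x t - p.
pose u t := gram Q (v t) (v t).
have vd t' : t1 <= t' -> is_derive t' 1 v (f (x t') (mu t')).
  move=> h; have := is_deriveB (xd t' h) (is_derive_cst p t' (1 : R)).
  by rewrite subr0.
have ud t' : t1 <= t' -> is_derive t' 1 u (2 * gram Q (f (x t') (mu t')) (v t')).
  by move=> h; apply: is_derive_gram; exact: vd.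
have uc : {within `[t1, t], continuous u}.
  apply: continuous_in_subspaceT => t'; rewrite inE /= in_itv /= => /andP[h _].
  exact: is_derive_continuous (ud t' h).
have ud' t' : t1 < t' < t -> is_derive t' 1 u (2 * gram Q (f (x t') (mu t')) (v t')).
  by move=> /andP[h _]; apply: ud; exact: ltW.
have decr t' : t1 < t' < t -> C * s ^+ 2 < u t' < c * e ^+ 2 ->
    2 * gram Q (f (x t') (mu t')) (v t') <= 0.
  move=> /andP[h _] /andP[us ue].
  have vs : s < `|v t'|.
    have := lt_le_trans us (le_trans (ler_norm _) (CP (v t') (v t'))).
    by rewrite ltr_pM2l// -expr2 ltr_pXn2r ?nnegrE ?(ltW s0).
  have ve : `|v t'| < e.
    have := le_lt_trans (cP (v t')) ue.
    by rewrite ltr_pM2l// ltr_pXn2r ?nnegrE ?(ltW e0).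
  have mut := mul t' (ltW h).
  rewrite -(subrK (f (x t') lam) (f (x t') (mu t'))) gramDl.
  have xE : x t' = v t' + p by rewrite subrK.
  have g1 : gram Q (f (x t') lam) (v t') <= - beta * `|v t'| ^+ 2.
    by rewrite xE; apply: Qb; exact: lt_le_trans ve _.
  have g2 : `|f (x t') (mu t') - f (x t') lam| <= L * eta.
    apply: (le_trans (fL (x t') (x t') (mu t') lam _ _ _ _)).
    - exact: lt_le_trans ve _.
    - exact: lt_le_trans ve _.
    - exact: lt_le_trans mut _.
    - by rewrite subrr normr0.
    - by rewrite subrr normr0 add0r ler_wpM2l// ltW.
  have g3 := le_trans (ler_norm _) (CP (f (x t') (mu t') - f (x t') lam) (v t')).
  have g4 : C * (L * eta) <= beta * s.
    move: etab; rewrite ler_pdivlMr ?mulr_gt0 ?ltr_wpDl// => etab.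
    by apply: le_trans etab; rewrite mulrCA mulrC; have := mulr_gt0 C0 eta0; nra.
  have g5 : C * (`|f (x t') (mu t') - f (x t') lam| * `|v t'|) <= beta * s * `|v t'|.
    rewrite mulrA ler_wpM2r//; apply: le_trans g4; rewrite ler_wpM2l// ltW//.
  have g6 : beta * s * `|v t'| <= beta * `|v t'| ^+ 2.
    by rewrite -mulrA expr2 ler_wpM2l ?(ltW beta0)// ler_wpM2r// ltW.
  lra.
have u1 : u t1 <= C * s ^+ 2.
  apply: (le_trans (ler_norm _)); apply: (le_trans (CP _ _)).
  by rewrite ler_wpM2l ?(ltW C0)// expr2 ler_pM// ltW.
have := barrier uc ud' sc decr u1; move=> /(_ t); rewrite tt1 lexx => /(_ isT) ut.
have := le_lt_trans (le_trans (cP (v t)) ut) sc.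
by rewrite ltr_pM2l// ltr_pXn2r ?nnegrE ?(ltW e0).
Qed.
End Stability.

(** * Forward invariance and global existence *)

Section Trajectories.
Variable R : realType.

Lemma before_near (T : \bar R) (s : R) : before T s ->
  exists2 d : R, 0 < d & forall u, `|u - s| < d -> before T u.
Proof.
case: T => [T| |] /=; rewrite /before /=.
- rewrite lte_fin => sT; exists (T - s); first by rewrite subr_gt0.
  by move=> u; rewrite lte_fin ltr_norml; lra.
- by move=> _; exists 1 => // u _; rewrite ltry.
- by rewrite ltNge leNye.
Qed.

Lemma before_le (T : \bar R) (s u : R) : u <= s -> before T s -> before T u.
Proof. by move=> us; apply: le_lt_trans; rewrite lee_fin. Qed.

Lemma before_interior (T : \bar R) (s : R) : before T s -> (before T)° s.
Proof.
move=> /before_near[d d0 dP]; apply/nbhs_ballP; exists d => // u.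
by rewrite -ball_normE /ball_ /= distrC; exact: dP.
Qed.

(** Take the supremum of the times up to t1 before which P holds throughout: the start near -oo
    makes it exist, the second hypothesis gives P there, and the third passes beyond it. *)
Lemma real_induction (T : \bar R) (P : R -> Prop) :
  (exists N, forall u, u < N -> P u) ->
  (forall s, before T s -> (forall u, u < s -> P u) -> P s) ->
  (forall s, before T s -> P s -> exists2 d, 0 < d & forall u, s < u < s + d -> P u) ->
  forall t, before T t -> P t.
Proof.
move=> [N PN] Pclosed Popen t1 t1T; apply: contrapT => nPt1.
pose S := [set t | t <= t1 /\ forall u, u <= t -> P u].
have S0 : S !=set0.
  exists (Num.min t1 (N - 1)); split; first by rewrite ge_min lexx.
  move=> u uN; apply: PN; apply: (le_lt_trans uN).
  by rewrite gt_min ltrBlDr ltrDl ltr01 orbT.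
have Sub : has_ubound S by exists t1 => t [].
pose s := sup S.
have st1 : s <= t1 by apply: ge_sup => // t [].
have Plt u : u < s -> P u.
  move=> us; have e0 : 0 < s - u by rewrite subr_gt0.
  have [t [_ tP] st] := sup_adherent e0 (conj S0 Sub).
  by apply: tP; move: st; rewrite -/s; lra.
have sT : before T s := before_le st1 t1T.
have Ps := Pclosed s sT Plt.
have st1' : s < t1.
  rewrite lt_neqAle st1 andbT; apply/eqP => E; apply: nPt1; by rewrite -E.
have [d d0 dP] := Popen s sT Ps.
pose s' := Num.min t1 (s + d / 2).
have ss' : s < s' by rewrite lt_min st1' ltrDl divr_gt0.
have : s' <= s.
  apply: ub_le_sup => //; split; first by rewrite ge_min lexx.
  move=> u us'; have [us|us|->//] := ltgtP u s; first exact: Plt.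
  apply: dP; rewrite us (le_lt_trans us')// gt_min; apply/orP; right; lra.
by rewrite leNgt ss'.
Qed.

Variable n : nat.
Local Notation E := 'rV[R]_n.
Variables (U : set E) (f : E -> R -> E).

Lemma solution_derive (g : R -> E -> E) (T : \bar R) (x : R -> E) t :
  solution_on U g (before T) x -> before T t -> is_derive t 1 x (g t (x t)).
Proof. by move=> [_ _ xd] /before_interior; exact: xd. Qed.

(** Monotonicity links the moving sets: an earlier set lies in K(rs), which is closed, so membership
    passes to the limit at s; and membership in K(rs) just after s implies membership in the later
    sets. *)
Lemma inflow_invariant (K : R -> set E) (Lam : R -> R) (r : R) (T : \bar R) (x :
  R -> E) :
  0 < r -> (forall s, compact (K s)) ->
  (forall s1 s2, s1 < s2 -> K s1 `<=` K s2) ->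
  (forall s p, (closure (K s) `\` (K s)°) p ->
     points_strictly_into (K s) p (f p (Lam s))) ->
  solution_on U (fun t y => f y (Lam (r * t))) (before T) x ->
  (exists N, forall u, u < N -> K (r * u) (x u)) ->
  forall t, before T t -> K (r * t) (x t).
Proof.
move=> r0 cK Kmono Kin xsol xN.
have xcont s : before T s -> {for s, continuous x}.
  by move=> sT; exact: is_derive_continuous (solution_derive xsol sT).
have near_ball s e : before T s -> 0 < e ->
    exists2 d, 0 < d & forall u, `|u - s| < d -> `|x u - x s| < e.
  move=> sT e0; have /cvgrPdist_lt/(_ e e0)/nbhs_ballP[d /= d0 dP] := xcont s sT.
  exists d => // u us; rewrite distrC; apply: dP.
  by rewrite -ball_normE /ball_ /= distrC.
apply: (@real_induction T (fun u => K (r * u) (x u)) xN) => s sT Ks.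
  apply: contrapT => nK.
  have cl : closed (K (r * s)) by apply: compact_closed => //; exact: norm_hausdorff.
  have /nbhs_ballP[e /= e0 eP] : nbhs (x s) (~` K (r * s)).
    by apply: open_nbhs_nbhs; split => //; exact: closed_openC.
  have [d d0 dP] := near_ball s e sT e0.
  have h : `|(s - d / 2) - s| < d by rewrite addrAC subrr sub0r normrN gtr0_norm
    ?divr_gt0//; lra.
  apply: (eP (x (s - d / 2))).
    by rewrite -ball_normE /ball_ /= distrC; exact: dP.
  apply: (Kmono (r * (s - d / 2))); first by rewrite ltr_pM2l//; lra.
  by apply: Ks; lra.
have grow u : s < u -> K (r * s) `<=` K (r * u).
  by move=> su; apply: Kmono; rewrite ltr_pM2l.
have [/nbhs_ballP[e /= e0 eP]|nint] := pselect ((K (r * s))° (x s)).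
  have [d d0 dP] := near_ball s e sT e0.
  exists d => // u /andP[su ud]; apply: (grow u su); apply: eP.
  rewrite -ball_normE /ball_ /= distrC; apply: dP.
  by rewrite gtr0_norm ?subr_gt0//; lra.
(* At a boundary point, x u is x s plus u - s times the difference quotient, which is within e of
   the field for u close to s. *)
have [|e e0 eP] := Kin (r * s) (x s).
  by split => //; exact: subset_closure.
have [xd dE] := solution_derive xsol sT.
have : (fun h : R => h^-1 *: (x (h *: (1 : R) + s) - x s)) @ 0^' --> f (x s)
  (Lam (r * s)).
  by rewrite -dE; exact: xd.
move=> /cvgrPdist_lt/(_ e e0)/nbhs_ballP[d /= d0 dP].
exists (Num.min d e); first by rewrite lt_min d0.
move=> u /andP[su ud]; apply: (grow u su).
have h0 : 0 < u - s by rewrite subr_gt0.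
have [hd he] : u - s < d /\ u - s < e by move: ud; rewrite -ltrBlDl lt_min => /andP[].
have := dP (u - s); rewrite -ball_normE /ball_ /= sub0r normrN gtr0_norm//.
move=> /(_ hd); rewrite gt_eqF// => /(_ isT); rewrite [_%:A]mulr1 subrK => q.
have := eP (u - s) ((u - s)^-1 *: (x u - x s)).
rewrite h0 he distrC => /(_ isT q).
by rewrite scalerA divff ?gt_eqF// scale1r addrC subrK.
Qed.

Hypothesis f_lip : locally_lipschitz U f.

(* If T were finite, the speed would be bounded near T, so x would have a limit in
   B there and could be continued by a local solution. *)
Lemma global_existence (B : set E) (lam : R -> R) (T : \bar R) (x : R -> E) :
  continuous lam -> compact B -> B `<=` U ->
  trajectory U (fun t y => f y (lam t)) T x ->
  (forall t, before T t -> B (x t)) -> T = +oo%E.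
Proof.
move=> lamc cB BU [TNy xsol xmax] xB.
case: T TNy xsol xmax xB => [T _ xsol xmax xB|//|]; last by rewrite ltxx.
exfalso.
have bT t : t < T -> before T%:E t by rewrite /before /= lte_fin.
have [K K0 KB] := bounded_near_compact f_lip (lam T) cB BU.
have [d d0 dP] : exists2 d : R, 0 < d & forall t, `|t - T| < d ->
  `|lam t - lam T| < K^-1.
  have K1 : 0 < K^-1 by rewrite invr_gt0.
  have /cvgrPdist_lt/(_ _ K1)/nbhs_ballP[d /= d0 dP] := lamc T.
  exists d => // t tT; rewrite distrC; apply: dP.
  by rewrite -ball_normE /ball_ /= distrC.
have xd t : t < T -> is_derive t 1 x (f (x t) (lam t)).
  by move=> tT; exact: (solution_derive xsol (bT t tT)).
have lipx s t : T - d < s -> s <= t -> t < T -> `|x t - x s| <= K * (t - s).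
  move=> ds st tT.
  apply: (@mean_value_ineq R n x (fun t => f (x t) (lam t))) => //.
  - by move=> u /andP[_ ut]; apply: xd; exact: lt_trans tT.
  - apply: continuous_in_subspaceT => u; rewrite inE /= in_itv /= => /andP[_ ut].
    by apply: is_derive_continuous (xd u _); exact: le_lt_trans tT.
  - move=> u /andP[su ut]; apply: KB; first by apply/xB/bT; exact: lt_trans tT.
    by apply: dP; rewrite ltr_norml; apply/andP; split; lra.
have [z [Bz zcl]] : B `&` cluster (x @ T^'-) !=set0.
  have xBT : \forall t \near T^'-, B (x t).
    near=> t; have tT : t < T by near: t; exact: nbhs_left_lt.
    exact: (xB t (bT t tT)).
  exact: (cB _ _ xBT).
(* Since x is Lipschitz near T, the cluster point z is its left limit, with a rate. *)
have xz t : T - d < t -> t < T -> `|x t - z| <= K * (T - t).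
  move=> dt tT; apply/ler_addgt0Pl => e e0.
  have A1 : \forall s \near T^'-, [set q | exists2 s, t < s < T & q = x s] (x s).
    near=> s; exists s => //; apply/andP; split.
      by near: s; exact: nbhs_left_gt.
    by near: s; exact: nbhs_left_lt.
  have [_ [[s /andP[ts sT] ->]]] := zcl _ _ A1 (nbhsx_ballx z e e0).
  rewrite -ball_normE /ball_ /= => zs.
  rewrite -(subrKA (x s)) (le_trans (ler_normD _ _))// addrC lerD//.
    by rewrite distrC ltW.
  rewrite distrC; apply: (le_trans (lipx t s dt (ltW ts) sT)).
  by rewrite ler_wpM2l ?(ltW K0)//; lra.
have [d1 [y [d10 yT yd]]] := local_solution f_lip T lamc (BU _ Bz).
pose w t := if t < T then x t else y t.
have wT : w T = z by rewrite /w ltxx.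
have yc : {for T, continuous y}.
  have [|_ ydT] := yd T; first by rewrite subrr normr0.
  exact: is_derive_continuous ydT.
have wc : {for T, continuous w}.
  apply/cvgrPdist_lt => e e0; rewrite wT.
  have K1 : 0 < e / (K + 1) by rewrite divr_gt0// addr_gt0.
  near=> t; rewrite /w; have [tT|tT] := ltP t T; last first.
    by near: t; move/cvgrPdist_lt: yc; rewrite yT; apply.
  have tn : T - t < e / (K + 1).
    have : `|T - t| < e / (K + 1).
      by near: t; move/cvgrPdist_lt: (@cvg_id _ (nbhs T)); apply.
    by rewrite gtr0_norm ?subr_gt0.
  have td : `|T - t| < d.
    by near: t; move/cvgrPdist_lt: (@cvg_id _ (nbhs T)); apply.
  rewrite distrC; apply: (@le_lt_trans _ _ (K * (T - t))).
    by apply: xz => //; move: td; rewrite gtr0_norm ?subr_gt0//; lra.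
  move: tn; rewrite ltr_pdivlMr ?addr_gt0//.
  have : 0 < T - t by rewrite subr_gt0.
  by lra.
(* Continuity at T of the field along the glued curve w is what provides the derivative of w at
   T. *)
pose g t := f (w t) (lam t).
have gc : {for T, continuous g}.
  have [rho [L [rho0 L0 _ fL]]] := f_lip (lam T) (BU _ Bz).
  apply/cvgrPdist_lt => e e0; rewrite /g wT.
  have e1 : 0 < e / (2 * (L + 1)) by rewrite divr_gt0// mulr_gt0// ltr_wpDl.
  near=> t.
  have w1 : `|z - w t| < rho by near: t; move/cvgrPdist_lt: wc; rewrite wT; apply.
  have w2 : `|z - w t| < e / (2 * (L + 1)) by near: t; move/cvgrPdist_lt: wc;
    rewrite wT; apply.
  have l1 : `|lam T - lam t| < rho by near: t; move/cvgrPdist_lt: (lamc T); apply.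
  have l2 : `|lam T - lam t| < e / (2 * (L + 1)) by near: t; move/cvgrPdist_lt:
    (lamc T); apply.
  apply: (@le_lt_trans _ _ (L * (`|z - w t| + `|lam T - lam t|))).
    by apply: fL; rewrite ?subrr ?normr0// distrC.
  apply: (@le_lt_trans _ _ (L * (e / (L + 1)))).
    rewrite ler_wpM2l//.
    have -> : e / (L + 1) = e / (2 * (L + 1)) + e / (2 * (L + 1)).
      by field; rewrite gt_eqF// ltr_wpDl.
    by rewrite lerD// ltW.
  by rewrite mulrCA gtr_pMr// ltr_pdivrMr ?ltr_wpDl// mul1r ltrDl.
have wd (t : R) : t < T + d1 -> is_derive t 1 w (g t).
  have wl (s : R) : s < T -> is_derive s 1 w (g s).
    move=> sT; have sN : \forall u \near s, x u = w u.
      near=> u; rewrite /w ifT//; near: u; exact: lt_nbhsl.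
    rewrite /g /w sT; apply: (near_eq_is_derive sN); exact: xd.
  have wr (s : R) : T < s -> s < T + d1 -> is_derive s 1 w (g s).
    move=> Ts sd; have sN : \forall u \near s, y u = w u.
      near=> u; rewrite /w ifF//; apply/negbTE; rewrite -leNgt ltW//.
      by near: u; exact: lt_nbhsr.
    have := yd s; rewrite gtr0_norm ?subr_gt0// => /(_ _)[|_ yds]; first lra.
    rewrite /g /w ltNge (ltW Ts) /=; exact: (near_eq_is_derive sN).
  move=> td; have [tT|Tt|->] := ltgtP t T; [exact: wl | exact: wr |].
  apply: (@is_derive_extend R n w g T d1 d10 wc gc) => s sT sd.
  have [h|h|h] := ltgtP s T; [exact: wl | | by rewrite h eqxx in sT].
  by apply: wr => //; move: sd; rewrite gtr0_norm ?subr_gt0//; lra.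
have TT : (T%:E <= (T + d1)%:E)%E by rewrite lee_fin lerDl ltW.
suff : (T + d1)%:E = T%:E by case; lra.
apply: (xmax _ w TT).
- have bd t : before (T + d1)%:E t -> t < T + d1 by rewrite /before /= lte_fin.
  split.
  + apply: continuous_in_subspaceT => t; rewrite inE => /bd td.
    exact: is_derive_continuous (wd t td).
  + move=> t /bd td; rewrite /w; case: ltP => tT; first exact/BU/xB/bT.
    by have [] := yd t; rewrite // ger0_norm ?subr_ge0//; lra.
  + by move=> t /interior_subset/bd; exact: wd.
- by move=> t; rewrite /before /= lte_fin /w => ->.
Unshelve. all: by end_near. Qed.
End Trajectories.

Theorem proposition4p3 (R : realType) (n : nat)
    (U : set 'rV[R]_n) (f : 'rV[R]_n -> R -> 'rV[R]_n)
    (lm lp : R) (Lam : R -> R) (X : R -> 'rV[R]_n) (Xm Xp : 'rV[R]_n) :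
  open U ->
  Ck_on 2 (U `*` [set: R]) (fun z : 'rV[R]_n * R => f z.1 z.2) ->
  lm < lp ->
  parameter_shift lm lp Lam ->
  stable_path U f lm lp Lam X Xm Xp ->
  forward_inflowing_stable U f lp Lam X Xm Xp ->
  ~ R_tipping U f Lam Xm Xp.
Proof.
move=> oU C2f _ [[dLam _] _ [_ Lam_p] _] [_ _ _ [_ attp]].
move=> [K [/all_and2[cK KU] [_ Kmono Kin [Kmint _] [Kpbasin cKp]]]].
(* The negated conclusion of tipping is applied, so both global existence and convergence remain to
   be proved. *)
move=> [r [r0 [T [x [[xtraj xm]]]]]]; apply.
have f_lip := C2_locally_lipschitz oU C2f.
have Upp : U Xp by case: attp.
have df : differentiable (f ^~ lp) Xp.
  have [dF _] := C2f.
  have dFp : differentiable (fun z : 'rV[R]_n * R => f z.1 z.2) (Xp, lp) by exact: dF.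
  apply: (@differentiable_comp _ _ _ _ (fun y : 'rV[R]_n => (y, lp)) _ _ _ dFp).
  exact: differentiable_pair.
have Lamc : continuous Lam by move=> s; apply/differentiable_continuous/dLam.
have lamc : continuous (fun t => Lam (r * t)).
  move=> t; apply: (@continuous_comp _ _ _ ( *%R r) Lam); last exact: Lamc.
  exact: mulrl_continuous.
set Kp := closure _ in Kpbasin cKp.
have KKp s : K s `<=` Kp by move=> p Kp_; apply: subset_closure; exists s.
(* The closure stays in U because each of its points is the initial value of a solution lying in
   U. *)
have KpU : Kp `<=` U.
  move=> p /Kpbasin[phi [[_ phiU _] <- _]]; apply: phiU.
  by rewrite /= in_itv /= lexx.
have [_ xsol _] := xtraj.
have xK t : before T t -> K (r * t) (x t).
  apply: (inflow_invariant r0 cK Kmono Kin xsol).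
  (* Near -oo, x lies in the neighbourhood K_- of Xm, hence in every K(s), in particular at the
     moving index r u. *)
  have := xm _ Kmint => -[N [_ NP]].
  by exists N => u uN; exact: (NP u uN (r * u) I).
have xKp t : before T t -> Kp (x t) by move=> /xK; exact: KKp.
have TE : T = +oo%E.
  exact: (global_existence f_lip lamc cKp KpU xtraj xKp).
split => //; move: xsol xKp; rewrite TE => {xK TE xtraj} xsol xKp.
have bT (t : R) : before +oo%E t by rewrite /before /= ltry.
have xd (t : R) : is_derive t 1 x (f (x t) (Lam (r * t)))
  := solution_derive xsol (bT t).
have xc : continuous x by move=> t; exact: is_derive_continuous (xd t).
apply/cvgrPdist_lt => e e0.
have [kappa k0 [eta1 eta10 trap]] := trapping f_lip df attp e0.
have [z [Kz zcl]] : Kp `&` cluster (x @ +oo) !=set0.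
  have xKpy : \forall t \near +oo, Kp (x t) by near=> t; exact: xKp.
  exact: (cKp _ _ xKpy).
have [phi [phisol phi0 phip]] := Kpbasin z Kz.
have k2 : 0 < kappa / 2 by rewrite divr_gt0.
have [tau tau0 phitau] : exists2 tau, 0 <= tau & `|Xp - phi tau| < kappa / 2.
  have : \forall t \near +oo, 0 <= t /\ `|Xp - phi t| < kappa / 2.
    near=> t; split; first by near: t; exact: nbhs_pinfty_ge.
    by near: t; move/cvgrPdist_lt: phip; apply.
  by move=> /filter_ex[t []]; exists t.
have [eta2 eta20 dep] := continuous_dependence f_lip phisol tau0 k2.
(* One time S serves both comparison with phi and trapping near Xp, since both take place after
   it. *)
have [S SP] : exists S, forall t, S <= t -> `|Lam (r * t) - lp| < Num.min eta1 eta2.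
  have m0 : 0 < Num.min eta1 eta2 by rewrite lt_min eta10.
  have /cvgrPdist_lt/(_ _ m0)[N [_ NP]] := Lam_p.
  exists ((N + 1) / r) => t; rewrite ler_pdivrMr// => Nt.
  by rewrite distrC; apply: NP; rewrite mulrC; lra.
have [t0 St0 xz] : exists2 t0, S <= t0 & `|x t0 - z| < eta2.
  have A1 : \forall t \near +oo, [set q | exists2 t, S <= t & q = x t] (x t).
    by near=> t; exists t => //; near: t; apply: nbhs_pinfty_ge; rewrite num_real.
  have [_ [[t St ->]]] := zcl _ _ A1 (nbhsx_ballx z eta2 eta20).
  by rewrite -ball_normE /ball_ /= distrC; exists t.
have xtau : `|x (t0 + tau) - Xp| < kappa.
  (* The limiting system is autonomous, so x restarted at t0 can be compared with phi, which starts
     from z at time 0. *)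
  have shift_d (s : R) : is_derive s 1 (fun s => x (s + t0)) (f (x (s + t0))
    (Lam (r * (s + t0)))).
    have [xds xdE] := xd (s + t0).
    have E : (fun h : R => h^-1 *: (x (h *: (1 : R) + s + t0) - x (s + t0))) =
             (fun h : R => h^-1 *: (x (h *: (1 : R) + (s + t0)) - x (s + t0))).
      by apply/funext => h; rewrite addrA.
    by apply: DeriveDef; [rewrite /derivable /= E | rewrite /derive /= E].
  have := dep (fun s => x (s + t0)) (fun s => Lam (r * (s + t0))).
  rewrite add0r phi0 [tau + t0]addrC => H.
  rewrite -(subrKA (phi tau)) (le_lt_trans (ler_normD _ _))//.
  suff : `|x (t0 + tau) - phi tau| < kappa / 2.
    by move: phitau; rewrite distrC; lra.
  apply: H => //.
  - by apply: continuous_subspaceT => s; exact: is_derive_continuous (shift_d s).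
  - move=> s /andP[s0 _]; have := SP (s + t0); rewrite lt_min => H'.
    by have /andP[] : (`|Lam (r * (s + t0)) - lp| < eta1) && (`|Lam (r * (s + t0))
      - lp| < eta2)
      by apply: H'; lra.
near=> t; rewrite distrC.
apply: (trap x (fun t => Lam (r * t)) (t0 + tau)) => //.
- by move=> u _; exact: xc.
- move=> u tu; have := SP u; rewrite lt_min => H.
  by have /andP[] : (`|Lam (r * u) - lp| < eta1) && (`|Lam (r * u) - lp| < eta2)
    by apply: H; lra.
Unshelve. all: by end_near. Qed.
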